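(* Let $\dot A$ be a non-negative symmetric Schrödinger operator as described in the context, with deficiency indices $(1,1)$, such that $m_\infty(-0)$ is finite and $m_\infty(-0)\ge0$. Let $\alpha\in(0,\pi]$ and let $\Theta_{\tan\alpha,i}$ be the Schrödinger L-system whose impedance function is $-m_\alpha$. Then $\Theta_{\tan\alpha,i}$ is accretive if and only if $\tan\alpha\ge\frac{1}{m_\infty(-0)}$ (with the conventions $1/0=+\infty$ and $\tan(\pi/2)=+\infty$).
   Context: Setting. Let $\ell\ge0$ and let $q$ be a real-valued locally summable function on $[\ell,\infty)$; put $l(y)=-y''+q(x)y$. In $\mathcal H=L^2[\ell,\infty)$ let $\dot A$ be the minimal symmetric operator $\dot Ay=l(y)$ with boundary conditions $y(\ell)=y'(\ell)=0$; it is assumed that $\dot A$ has deficiency indices $(1,1)$ and is non-negative: $(\dot Ay,y)\ge0$ for $y\in\mathrm{dom}(\dot A)$. Let $\mathcal H_+=\mathrm{dom}(\dot A^* )$ with inner product $(y,z)_+=\int_\ell^\infty(y\bar z+l(y)\overline{l(z)})\,dx$, and let $\mathcal H_+\subset L^2[\ell,\infty)\subset\mathcal H_-$ be the associated rigged Hilbert space; $\delta(x-\ell),\delta'(x-\ell)\in\mathcal H_-$ act by $(y,\delta(x-\ell))=y(\ell)$, $(y,\delta'(x-\ell))=-y'(\ell)$. Weyl–Titchmarsh functions. For $z\in\mathbb C\setminus\mathbb R$ let $\varphi_1,\varphi_2$ solve $l(\varphi)=z\varphi$ with $\varphi_1(\ell)=0,\varphi_1'(\ell)=1$, $\varphi_2(\ell)=-1,\varphi_2'(\ell)=0$;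 $m_\infty(z)$ is the unique number such that $\varphi_2+m_\infty(z)\varphi_1\in L^2[\ell,\infty)$. For $\alpha\in\mathbb R$ put $m_\alpha(z)=\frac{\sin\alpha+m_\infty(z)\cos\alpha}{\cos\alpha-m_\infty(z)\sin\alpha}$. For non-negative $\dot A$, $m_\infty(-0)=\lim_{x\uparrow0}m_\infty(x)$ denotes the limit of $m_\infty$ at $0$ from the left along the negative real axis. Schrödinger L-systems. For $h\in\mathbb C$ with $\operatorname{Im}h>0$ and $\mu\in\mathbb R\cup\{\infty\}$, the Schrödinger L-system $\Theta_{\mu,h}$ consists of the rigged space above, the main operator $T_hy=l(y)$ on $\{y\in\mathcal H_+: y'(\ell)=hy(\ell)\}$, the state-space operator $\mathbb A_{\mu,h}:\mathcal H_+\to\mathcal H_-$, $\mathbb A_{\mu,h}y=l(y)-\frac1{\mu-h}[y'(\ell)-hy(\ell)][\mu\delta(x-\ell)+\delta'(x-\ell)]$ (for $\mu=\infty$: $l(y)-[y'(\ell)-hy(\ell)]\delta(x-\ell)$), and the channel operator $K_{\mu,h}c=c\,g_{\mu,h}$, $g_{\mu,h}=\frac{(\operatorname{Im}h)^{1/2}}{|\mu-h|}[\mu\delta(x-\ell)+\delta'(x-\ell)]$ (for $\mu=\infty$: $(\operatorname{Im}h)^{1/2}\delta(x-\ell)$). Its impedance function $V_\Theta(z)=K^*(\operatorname{Re}\mathbb A-zI)^{-1}K$ is known to equal $\frac{(m_\infty(z)+\mu)\operatorname{Im}h}{(\mu-\operatorname{Re}h)m_\infty(z)+\mu\operatorname{Re}h-|h|^2}$;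 in particular $V_{\Theta_{\tan\alpha,i}}=-m_\alpha$. An L-system is called accretive if its state-space operator satisfies $\operatorname{Re}(\mathbb Ay,y)\ge0$ for all $y\in\mathcal H_+$ (pairing between $\mathcal H_-$ and $\mathcal H_+$). *)

(* Defs.v *)
(* R : realType, complex numbers C = complex R
   (mathcomp real_closed, a numClosedFieldType). *)
From HB Require Import structures.
From mathcomp Require Import all_boot all_order all_algebra.
From mathcomp Require Import all_classical all_reals all_analysis.
From mathcomp Require Import complex.
Set Implicit Arguments. Unset Strict Implicit. Unset Printing Implicit Defensive.
Import Order.TTheory GRing.Theory Num.Theory.
Local Open Scope classical_set_scope.
Local Open Scope ring_scope.

Notation Cx R := (complex.complex R).

(* embedding of reals into complex numbers *)
Definition rC {R : realType} (r : R) : Cx R := complex.Complex r 0.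

Definition Leb {R : realType} := (@lebesgue_measure R).

(* f : R -> C is Lebesgue integrable on D (real and imaginary parts) *)
Definition cintegrable {R : realType} (D : set R) (f : R -> Cx R) : Prop :=
  Leb.-integrable D (EFin \o (fun x => complex.Re (f x))) /\
  Leb.-integrable D (EFin \o (fun x => complex.Im (f x))).

(* Lebesgue integral of a complex-valued function over D *)
Definition cint {R : realType} (D : set R) (f : R -> Cx R) : Cx R :=
  complex.Complex (Rintegral Leb D (fun x => complex.Re (f x)))
                  (Rintegral Leb D (fun x => complex.Im (f x))).

(* f belongs to L^2[l, oo) *)
Definition L2 {R : realType} (l : R) (f : R -> Cx R) : Prop :=
  measurable_fun `[l, +oo[ (fun x => complex.Re (f x)) /\
  measurable_fun `[l, +oo[ (fun x => complex.Im (f x)) /\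
  Leb.-integrable `[l, +oo[
     (fun x => ((complex.Re (f x)) ^+ 2 + (complex.Im (f x)) ^+ 2)%:E).

(* q is real-valued and locally summable on [l, oo) *)
Definition loc_summable {R : realType} (l : R) (q : R -> R) : Prop :=
  forall b : R, l <= b -> Leb.-integrable `[l, b] (EFin \o q).

(* lsol l q y dy f : on [l,oo), y is absolutely continuous with derivative dy,
   dy is absolutely continuous, and l(y) = -y'' + q y = f  (a.e.), i.e.
   y(x) = y(l) + int_l^x dy  and  dy(x) = dy(l) + int_l^x (q y - f). *)
Definition lsol {R : realType} (l : R) (q : R -> R)
    (y dy f : R -> Cx R) : Prop :=
  forall x : R, l <= x ->
    cintegrable `[l, x] dy /\
    cintegrable `[l, x] (fun t => rC (q t) * y t - f t) /\
    y x = y l + cint `[l, x] dy /\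
    dy x = dy l + cint `[l, x] (fun t => rC (q t) * y t - f t).

(* y in H_+ = dom(A-star), with quasi-derivative dy and l(y) = f *)
Definition maxdom {R : realType} (l : R) (q : R -> R) (y dy f : R -> Cx R) :
  Prop := lsol l q y dy f /\ L2 l y /\ L2 l f.

(* L^2[l,oo) inner product (f, g) = int f conj(g) *)
Definition inner {R : realType} (l : R) (f g : R -> Cx R) : Cx R :=
  cint `[l, +oo[ (fun x => f x * (g x)^*).

(* the minimal operator (y(l) = y'(l) = 0) is non-negative *)
Definition min_nonneg {R : realType} (l : R) (q : R -> R) : Prop :=
  forall y dy f, maxdom l q y dy f -> y l = 0 -> dy l = 0 ->
    0 <= inner l f y.

(* deficiency indices (1,1): dim ker(A-star - z) = 1 for z = i and z = -i *)
Definition deficiency11 {R : realType} (l : R) (q : R -> R) : Prop :=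
  forall z : Cx R, z = 'i \/ z = - 'i ->
    exists y0 dy0, maxdom l q y0 dy0 (fun x => z * y0 x) /\
      (exists x, l <= x /\ y0 x != 0) /\
      forall y dy, maxdom l q y dy (fun x => z * y x) ->
        exists c : Cx R, forall x, l <= x -> y x = c * y0 x.

(* is_minf l q z m : m is the Weyl-Titchmarsh value m_oo(z), i.e.
   phi2 + m phi1 is in L^2 where l(phi) = z phi,
   phi1(l) = 0, phi1'(l) = 1, phi2(l) = -1, phi2'(l) = 0 *)
Definition is_minf {R : realType} (l : R) (q : R -> R) (z m : Cx R) : Prop :=
  exists p1 dp1 p2 dp2 : R -> Cx R,
    lsol l q p1 dp1 (fun x => z * p1 x) /\ p1 l = 0 /\ dp1 l = 1 /\
    lsol l q p2 dp2 (fun x => z * p2 x) /\ p2 l = -1 /\ dp2 l = 0 /\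
    L2 l (fun x => p2 x + m * p1 x).

(* m_oo(-0) = lim_{x -> 0, x < 0} m_oo(x) exists and equals the real L *)
Definition minf_left_limit {R : realType} (l : R) (q : R -> R) (L : R) : Prop :=
  forall eps : R, 0 < eps -> exists2 delta : R, 0 < delta &
    forall x : R, - delta < x < 0 ->
      exists m, is_minf l q (rC x) m /\ `|m - rC L| < rC eps.

(* (A y, y) for the state-space operator A_{tan alpha, i} of the L-system
   Theta_{tan alpha, i}; for alpha = pi/2 (tan alpha = oo) the mu = oo formula.
   Here (delta, y) = conj(y(l)), (delta', y) = - conj(y'(l)). *)
Definition state_form {R : realType} (l : R) (alpha : R) (y dy f : R -> Cx R) :
  Cx R :=
  if alpha == pi / 2 then
    inner l f y - (dy l - 'i * y l) * (y l)^*
  else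
    let mu := rC (tan alpha) in
    inner l f y - (dy l - 'i * y l) / (mu - 'i) * (mu * (y l)^* - (dy l)^*).

(* Theta_{tan alpha, i} is accretive: Re (A y, y) >= 0 for all y in H_+ *)
Definition accretive_L {R : realType} (l : R) (q : R -> R) (alpha : R) : Prop :=
  forall y dy f, maxdom l q y dy f ->
    0 <= complex.Re (state_form l alpha y dy f).

(* tan alpha >= 1 / L, with 1/0 = +oo and tan(pi/2) = +oo *)
Definition tan_ge_inv {R : realType} (alpha L : R) : Prop :=
  alpha = pi / 2 \/ (0 < L /\ L^-1 <= tan alpha).

(* Main.v *)
(* For y in H_+ put D[y] = (l(y), y) - y'(l) conj(y(l)), formally the Dirichlet
   form. The accretivity of Theta_{tan alpha, i} is the positivity of
   Re D[y] plus a quadratic form in (y(l), y'(l)), so everything reduces to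
   inf D[y] = m_oo(-0) |y(l)|^2, where the infimum is taken with both y(l) and
   y'(l) prescribed. For x < 0 the Weyl solution psi = phi_2 + m_oo(x) phi_1 has
   D[psi] <= m_oo(x), and elements of H_+ concentrated near the endpoint
   change y'(l) at arbitrarily small cost. The lower bound says that the form
   (l(u), u) is non-negative on {u(l) = 0}; this follows from the non-negativity
   of the minimal operator by the same concentrated elements. They cannot be
   obtained by cutting off (q is only locally summable), so they are built with
   the Green function at x out of phi_1 and psi.
   All this is real: the real parts of phi_1 and psi suffice, and a complex y
   splits into real and imaginary parts. *)
Require Import Defs.
From HB Require Import structures.
From mathcomp Require Import all_boot all_order all_algebra.
From mathcomp Require Import all_classical all_reals all_analysis.
From mathcomp Require Import complex.
From mathcomp Require Import ring lra measurable_realfun.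
Import Order.TTheory GRing.Theory Num.Theory.
Local Open Scope ring_scope.

(** * Absolutely continuous functions and the real L2 space on a half-line *)

Section Calculus.
Set Implicit Arguments. Unset Strict Implicit. Unset Printing Implicit Defensive.
Local Open Scope classical_set_scope.
Local Open Scope ring_scope.
Import numFieldNormedType.Exports.
Context {R : realType}.
Implicit Types (F G f g h y z : R -> R) (l a b c e x t eps : R).
Local Notation mu := (@lebesgue_measure R).

(** The density [f] is carried as data and enters only through its integrals, the integral form that
    [lsol] also uses. Values to the left of [l] are left free. *)
Definition ac l F f := forall x, l <= x ->
  mu.-integrable `[l, x] (EFin \o f) /\ F x = F l + Rintegral mu `[l, x] f.

Lemma ac_lin l a b F f G g : ac l F f -> ac l G g ->
  ac l (fun x => a * F x + b * G x) (fun x => a * f x + b * g x).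
Proof.
move=> hF hG x lx; have [fi Fx] := hF x lx; have [gi Gx] := hG x lx.
have afi : mu.-integrable `[l, x] (EFin \o (fun x => a * f x)).
  exact: (integrableZl _ a fi).
have bgi : mu.-integrable `[l, x] (EFin \o (fun x => b * g x)).
  exact: (integrableZl _ b gi).
split; first exact: (integrableD _ afi bgi).
rewrite RintegralD// RintegralZl// RintegralZl// Fx Gx; ring.
Qed.

Lemma ac_eq l F f G g : ac l F f -> (forall x, l <= x -> F x = G x) ->
  (forall x, l <= x -> f x = g x) -> ac l G g.
Proof.
move=> hF FG fg x lx; have [fi Fx] := hF x lx.
have fgin : {in `[l, x]%classic, f =1 g}.
  by move=> t; rewrite inE/= in_itv/= => /andP[lt _]; rewrite fg.
split; first by apply: eq_integrable fi => // t tD; rewrite /= fgin.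
by rewrite -!FG// Fx; congr (_ + _); apply: eq_Rintegral.
Qed.

Lemma ac_cst l a : ac l (cst a) (cst 0).
Proof.
move=> x lx; split; first exact: integrable0.
by rewrite Rintegral_cst// mul0r addr0.
Qed.

Lemma ac_norm_le l F f x : ac l F f -> l <= x -> forall t, l <= t <= x ->
  `|F t| <= `|F l| + Rintegral mu `[l, x] (fun s => `|f s|).
Proof.
move=> hF lx t /andP[lt tx]; have [fi ->] := hF t lt; have [fx _] := hF x lx.
rewrite (le_trans (ler_normD _ _))// lerD2l.
rewrite (le_trans (le_normr_Rintegral _ _))//.
have fxn := integrable_norm fx.
rewrite -subr_ge0 (@Rintegral_itvB R _ _ (BRight x) t)// ?bnd_simp//.
by apply: Rintegral_ge0.
Qed.

Lemma ac_continuous l F f x : ac l F f -> l <= x ->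
  {within `[l, x], continuous F}.
Proof.
move=> hF lx; have [fx _] := hF x lx.
apply: (@subspace_eq_continuous _ _ _ (fun t => F l + parameterized_integral mu l t f)).
  move=> t; rewrite inE/= in_itv/= => /andP[lt _].
  by symmetry; exact: (hF t lt).2.
move=> t; apply: cvgD; first exact: cvg_cst.
exact: (parameterized_integral_continuous lx fx).
Qed.

Lemma itvcy_bigcup l : `[l, +oo[%classic = \bigcup_n `[l, l + n%:R]%classic :> set R.
Proof.
apply/seteqP; split=> [t|t [n _]] /=; rewrite !in_itv/= ?andbT; last by case/andP.
move=> lt; have tl : 0 <= t - l by rewrite subr_ge0.
exists (Num.bound (t - l)) => //=; rewrite in_itv/= lt/=.
by have := archi_boundP tl; lra.
Qed.

Lemma ac_measurable l F f : ac l F f -> measurable_fun `[l, +oo[ F.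
Proof.
move=> hF; rewrite itvcy_bigcup; apply/measurable_fun_bigcup => // n.
apply: subspace_continuous_measurable_fun => //.
by apply: ac_continuous hF _; rewrite lerDl.
Qed.

Lemma ac_measurable_itv l F f x : ac l F f -> measurable_fun `[l, x] F.
Proof.
move=> hF; apply: measurable_funS (ac_measurable hF) => //.
by apply: subset_itvl.
Qed.

Lemma ac_mul_integrable l F f g x : ac l F f -> l <= x ->
  mu.-integrable `[l, x] (EFin \o g) ->
  mu.-integrable `[l, x] (EFin \o (fun t => g t * F t)).
Proof.
move=> hF lx gi.
apply: (integrableMl _ gi (ac_measurable_itv (x := x) hF)) => //.
exists (`|F l| + Rintegral mu `[l, x] (fun s => `|f s|)); split => [|M hM t /=]; first exact: num_real.
rewrite in_itv/= => tx; apply: le_trans (ltW hM); exact: ac_norm_le hF _ _ _.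
Qed.

(** The shape of the inner integrals in Fubini's theorem once functions on an interval are extended
    by zero. *)
Lemma integral_scale_patch (c : R) (h : R -> R) a b :
  mu.-integrable `[a, b] (EFin \o h) ->
  (\int[mu]_t (c * (h \_ `[a, b]) t)%:E)%E = (c * Rintegral mu `[a, b] h)%:E.
Proof.
move=> hi; rewrite /Rintegral EFinM fineK; last exact: integrable_fin_num.
rewrite -integralZl// [RHS]integral_mkcond; apply: eq_integral => t _.
by rewrite EFinM !patchE; case: ifP => //; rewrite mule0.
Qed.

(** Both sides integrate [f t * g s] over the triangle [l <= s <= t <= x]. The kernel [k] encodes
    this on the whole plane, with [f] and [g] extended by zero. *)
Lemma fubini_triangle l x f g : l <= x ->
  mu.-integrable `[l, x] (EFin \o f) -> mu.-integrable `[l, x] (EFin \o g) ->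
  Rintegral mu `[l, x] (fun t => f t * Rintegral mu `[l, t] g) =
  Rintegral mu `[l, x] (fun s => g s * Rintegral mu `[s, x] f).
Proof.
move=> lx fi gi.
have f0i : mu.-integrable setT (EFin \o (f \_ `[l, x])).
  by rewrite -restrict_EFin; apply/integrable_restrict => //; rewrite setTI.
have g0i : mu.-integrable setT (EFin \o (g \_ `[l, x])).
  by rewrite -restrict_EFin; apply/integrable_restrict => //; rewrite setTI.
have /measurable_EFinP mf0 := measurable_int mu f0i.
have /measurable_EFinP mg0 := measurable_int mu g0i.
pose GR := measurableTypeR R.
pose k (z : GR * GR) : R := if z.2 <= z.1 then (f \_ `[l, x]) z.1 * (g \_ `[l, x]) z.2 else 0.
have mk : measurable_fun [set: GR * GR] k.
  apply: measurable_fun_if => //; first exact: measurable_fun_ler.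
    apply: measurable_funTS; apply: measurable_funM.
      exact: measurableT_comp mf0 measurable_fst.
    exact: measurableT_comp mg0 measurable_snd.
have mEk : measurable_fun [set: GR * GR] (EFin \o k) by apply/measurable_EFinP.
have [_ ik] := @integrable12ltyP _ _ _ _ _ mu mu _ mEk.
(* The kernel is dominated by the product of the absolute values of the two extensions, whose double
   integral factors. *)
have ik0 : (\int[mu]_t \int[mu]_s `|(EFin \o k) (t, s)| < +oo)%E.
  apply: (@le_lt_trans _ _ (\int[mu]_t (`|(f \_ `[l, x]) t|%:E * \int[mu]_s `|(g \_ `[l, x]) s|%:E))%E).
    apply: ge0_le_integral => //.
    - by move=> t _; apply: integral_ge0.
    - apply: (measurable_fun_fubini_tonelli_F (abse \o (EFin \o k))) => //=.
      exact: measurableT_comp.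
    - apply: emeasurable_funM => //.
      by apply/measurable_EFinP; apply: measurableT_comp.
    move=> t _; rewrite -ge0_integralZl//; last first.
      by apply/measurable_EFinP; apply: measurableT_comp.
    apply: ge0_le_integral => //=.
    - by apply/measurable_EFinP; apply: measurableT_comp => //; apply: measurableT_comp (pair1_measurable _).
    - by apply/measurable_EFinP; apply: measurable_funM => //; apply: measurableT_comp.
    move=> s _; rewrite lee_fin /k/=; case: ifP => _; first by rewrite normrM.
    by rewrite normr0 mulr_ge0.
  have /integrableP[_ fo] := f0i; have /integrableP[_ go] := g0i.
  rewrite ge0_integralZr//; last 2 first.
  - by apply/measurable_EFinP; apply: measurableT_comp.
  - by apply: integral_ge0.
  by apply: lte_mul_pinfty => //; [exact: integral_ge0|rewrite ge0_fin_numE//; exact: integral_ge0].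
have := Fubini (ik ik0).
have inL t : (\int[mu]_s (EFin \o k) (t, s))%E =
    (((fun t => f t * Rintegral mu `[l, t] g) \_ `[l, x]) t)%:E.
  rewrite patchE; case: ifPn => [|tD]; last first.
    rewrite integral0_eq// => s _; rewrite /k/= patchE (negbTE tD) mul0r.
    by case: ifP.
  rewrite inE/= in_itv/= => /andP[lt tx].
  rewrite -integral_scale_patch; last first.
    by apply: integrableS gi => //; apply: subset_itvl; rewrite bnd_simp.
  apply: eq_integral => s _; rewrite /k/= !patchE !mem_setE/= !in_itv/= lt tx/=.
  have [st|ts] := leP s t; rewrite ?andbT ?andbF ?mulr0//.
  by rewrite (le_trans st tx) andbT.
have inR s : (\int[mu]_t (EFin \o k) (t, s))%E =
    (((fun s => g s * Rintegral mu `[s, x] f) \_ `[l, x]) s)%:E.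
  rewrite patchE; case: ifPn => [|sD]; last first.
    rewrite integral0_eq// => t _; rewrite /k/= [(g \_ _) _]patchE (negbTE sD) mulr0.
    by case: ifP.
  rewrite inE/= in_itv/= => /andP[ls sx].
  rewrite -integral_scale_patch; last first.
    by apply: integrableS fi => //; apply: subset_itvr; rewrite bnd_simp.
  apply: eq_integral => t _; rewrite /k/= !patchE !mem_setE/= !in_itv/= ls sx/=.
  have [st|ts] := leP s t; rewrite ?andbT ?andbF ?mulr0//=.
  by rewrite (le_trans ls st) mulrC.
move=> h; rewrite [LHS]Rintegral_mkcond [RHS]Rintegral_mkcond.
transitivity (fine (\int[mu]_t \int[mu]_s (EFin \o k) (t, s))%E).
  by apply: (congr1 fine); apply: eq_integral => t _; rewrite inL.
by rewrite h; apply: (congr1 fine); apply: eq_integral => s _; rewrite inR.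
Qed.

(** Integration by parts: write [G t - G l] and [F x - F t] as integrals of [g] and [f], then apply
    [fubini_triangle]. *)
Lemma ac_mul l F f G g : ac l F f -> ac l G g ->
  ac l (fun x => F x * G x) (fun x => f x * G x + F x * g x).
Proof.
move=> hF hG x lx; have [fi Fx] := hF x lx; have [gi Gx] := hG x lx.
have i1 := ac_mul_integrable hG lx fi; have i2 := ac_mul_integrable hF lx gi.
have ig t : l <= t <= x -> mu.-integrable `[t, x] (EFin \o f).
  case/andP=> lt tx; apply: integrableS fi => //.
  by apply: subset_itvr; rewrite bnd_simp.
have i2' : mu.-integrable `[l, x] (EFin \o (fun t => F t * g t)).
  by under [X in _.-integrable _ X]eq_fun do rewrite /= mulrC.
split; first exact: (integrableD _ i1 i2').
have tail t : l <= t <= x -> Rintegral mu `[t, x] f = F x - F t.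
  case/andP=> lt tx; have [fti ->] := hF t lt; rewrite Fx.
  have := @Rintegral_itvB R f (BLeft l) (BRight x) t fi.
  rewrite !bnd_simp => /(_ lt tx); rewrite Rintegral_itv_obnd_cbnd; first lra.
  by apply: integrableS (ig t _) => //; [exact: subset_itv_oc_cc|rewrite lt].
have e1 : Rintegral mu `[l, x] (fun t => f t * Rintegral mu `[l, t] g) =
    Rintegral mu `[l, x] (fun t => f t * G t) - G l * (F x - F l).
  transitivity (Rintegral mu `[l, x] (fun t => f t * G t - G l * f t)).
    apply: eq_Rintegral => t; rewrite inE/= in_itv/= => /andP[lt tx].
    by have [_ ->] := hG t lt; ring.
  rewrite RintegralB//; last exact: (integrableZl _ (G l) fi).
  by rewrite RintegralZl// Fx; ring.
have e2 : Rintegral mu `[l, x] (fun t => g t * Rintegral mu `[t, x] f) =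
    F x * (G x - G l) - Rintegral mu `[l, x] (fun t => F t * g t).
  transitivity (Rintegral mu `[l, x] (fun t => F x * g t - F t * g t)).
    apply: eq_Rintegral => t; rewrite inE/= in_itv/= => /andP[lt tx].
    by rewrite tail ?lt//; ring.
  rewrite RintegralB//; last exact: (integrableZl _ (F x) gi).
  by rewrite RintegralZl// Gx; ring.
have := fubini_triangle lx fi gi; rewrite e1 e2 RintegralD//; lra.
Qed.

Lemma ac0_const l F f x : ac l F f -> (forall t, l <= t -> f t = 0) -> l <= x ->
  F x = F l.
Proof.
move=> hF f0 lx; have [_ ->] := hF x lx.
rewrite (_ : Rintegral _ _ _ = 0) ?addr0//.
transitivity (Rintegral mu `[l, x] (cst 0)); last by rewrite Rintegral_cst// mul0r.
by apply: eq_Rintegral => t; rewrite inE/= in_itv/= => /andP[/f0].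
Qed.

Lemma ac_primitive l h :
  (forall x, l <= x -> mu.-integrable `[l, x] (EFin \o h)) ->
  ac l (fun x => Rintegral mu `[l, x] h) h.
Proof.
move=> hi x lx; split; first exact: hi.
by rewrite set_itv1 Rintegral_set1 add0r.
Qed.

Lemma Rintegral_support l e x h : l <= e -> e <= x ->
  mu.-integrable `[l, x] (EFin \o h) -> (forall t, e < t -> h t = 0) ->
  Rintegral mu `[l, x] h = Rintegral mu `[l, e] h.
Proof.
move=> le ex hi h0; apply/eqP; rewrite -subr_eq0 Rintegral_itvB ?bnd_simp//.
apply/eqP; transitivity (Rintegral mu `]e, x] (cst 0)).
  by apply: eq_Rintegral => t; rewrite inE/= in_itv/= => /andP[/h0].
by rewrite Rintegral_cst// mul0r.
Qed.

Lemma integrable_cst_itv a b c : mu.-integrable `[a, b] (EFin \o (cst c : R -> R)).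
Proof.
apply: continuous_compact_integrable; first exact: segment_compact.
by apply: continuous_subspaceT => t; exact: cvg_cst.
Qed.

Lemma Rintegral_abs_le a b c h : a <= b ->
  mu.-integrable `[a, b] (EFin \o h) -> (forall t, a <= t <= b -> `|h t| <= c) ->
  `|Rintegral mu `[a, b] h| <= c * (b - a).
Proof.
move=> ab hi hc; apply: (le_trans (le_normr_Rintegral _ _)) => //.
have -> : c * (b - a) = Rintegral mu `[a, b] (cst c).
  rewrite Rintegral_cst//= lebesgue_measure_itv/= lte_fin.
  by move: ab; rewrite le_eqVlt => /predU1P[->|->]; rewrite ?ltxx/= ?subrr.
apply: le_Rintegral => //; first exact: integrable_norm.
exact: integrable_cst_itv.
Qed.

Lemma ac_right_continuous l F f eps : ac l F f -> 0 < eps ->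
  exists2 d, 0 < d & forall t, l <= t <= l + d -> `|F t - F l| <= eps.
Proof.
move=> hF e0; have l1 : l < l + 1 by rewrite ltrDl.
have [fi _] := hF _ (ltW l1).
have [d /= d0 hd] := parameterized_integral_near_left l1 e0 fi.
exists (d / 2); first by rewrite divr_gt0.
move=> t /andP[lt td]; have [_ ->] := hF t lt.
rewrite addrC addKr; apply: ltW; apply: hd => //=.
by rewrite ler0_norm ?subr_le0// opprB; lra.
Qed.

(** The error is at most the tail of the integral of [|h|], which decreases in [b] and tends to 0 by
    monotone convergence over [[l, l + n]]. *)
Lemma integrable_tail l h eps : mu.-integrable `[l, +oo[ (EFin \o h) -> 0 < eps ->
  exists2 N, l <= N & forall b, N <= b ->
    `|Rintegral mu `[l, +oo[ h - Rintegral mu `[l, b] h| <= eps.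
Proof.
move=> hi e0; have ni := integrable_norm hi.
have sub b : l <= b -> `[l, b]%classic `<=` `[l, +oo[.
  by move=> lb; apply: subset_itvl.
have nb b : l <= b -> mu.-integrable `[l, b] (EFin \o (fun t => `|h t|)).
  by move=> lb; apply: integrableS ni => //; exact: sub.
have cv : (\int[mu]_(t in `[l, (l + n%:R)%R]) (`|h t|)%:E)%E @[n --> \oo] -->
    (\int[mu]_(t in `[l, +oo[) (`|h t|)%:E)%E.
  rewrite itvcy_bigcup; apply: ge0_nondecreasing_set_cvg_integral => //.
  - apply/nondecreasing_seqP => n; rewrite subsetEset; apply: subset_itvl.
    by rewrite bnd_simp lerD2l ler_nat.
  - move=> n; apply: (measurable_int mu); apply: nb; by rewrite lerDl.
have fE : (\int[mu]_(t in `[l, +oo[) (`|h t|)%:E)%E =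
    (Rintegral mu `[l, +oo[ (fun t => `|h t|))%:E.
  by rewrite /Rintegral fineK//; apply: integrable_fin_num.
rewrite fE in cv; move/fine_cvgP : cv => [_ /cvgrPdist_le /(_ _ e0) [n _ hn]].
exists (l + n%:R); first by rewrite lerDl.
move=> b nb'; have lb : l <= b by rewrite (le_trans _ nb')// lerDl.
rewrite Rintegral_itvB// ?bnd_simp//.
apply: le_trans (le_normr_Rintegral _ _) _ => //.
  by apply: integrableS hi => //; apply: subset_itvr; rewrite bnd_simp.
have := hn n (leqnn _); rewrite /= => /(le_trans (ler_norm _)); apply: le_trans.
rewrite -(@Rintegral_itvB _ _ (BLeft l) +oo%O b)// ?bnd_simp// lerD2l lerN2.
rewrite -subr_ge0 Rintegral_itvB ?bnd_simp//; first exact: Rintegral_ge0.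
exact: nb.
by rewrite lerDl.
Qed.

Lemma Rintegral_ge_cst a b c h : a <= b -> mu.-integrable `[a, b] (EFin \o h) ->
  (forall t, a <= t <= b -> c <= h t) -> c * (b - a) <= Rintegral mu `[a, b] h.
Proof.
move=> ab hi hc.
have <- : Rintegral mu `[a, b] (cst c) = c * (b - a).
  rewrite Rintegral_cst//= lebesgue_measure_itv/= lte_fin.
  by move: ab; rewrite le_eqVlt => /predU1P[->|->]; rewrite ?ltxx/= ?subrr.
apply: le_Rintegral => //; exact: integrable_cst_itv.
Qed.

(** If [A > 0], the value [eta = 1/2] forces [C > 0], and then [eta = A / (2 (C + A))] would give
    [A < A / 2]. The range [eta <= 1/2] is the one in which [localized] provides its estimates. *)
Lemma le0_of_eps (A C : R) : (forall eta, 0 < eta -> eta <= 2^-1 -> A <= C * eta) -> A <= 0.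
Proof.
move=> h; rewrite leNgt; apply/negP => A0.
have C0 : 0 < C by have := h 2^-1; lra.
have M0 : 0 < 2 * (C + A) by lra.
have := h (A / (2 * (C + A))) (divr_gt0 A0 M0) _.
rewrite ler_pdivrMr// => /(_ ltac:(lra)).
rewrite mulrA ler_pdivlMr//; nra.
Qed.

(** * The real space L2 on the half-line and its inner product *)

Definition L2r l f := measurable_fun `[l, +oo[ f /\
  mu.-integrable `[l, +oo[ (EFin \o (fun x => f x ^+ 2)).

Definition dot l f g := Rintegral mu `[l, +oo[ (fun x => f x * g x).

Lemma L2r_mul l f g : L2r l f -> L2r l g ->
  mu.-integrable `[l, +oo[ (EFin \o (fun x => f x * g x)).
Proof.
move=> [mf fi] [mg gi]; apply: le_integrable (integrableD _ fi gi) => //.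
  by apply/measurable_EFinP; exact: measurable_funM.
move=> x _ /=; rewrite lee_fin [leRHS]ger0_norm ?normrM ?addr_ge0 ?sqr_ge0//.
have := real_normK (num_real (f x)); have := real_normK (num_real (g x)).
have := normr_ge0 (f x); have := normr_ge0 (g x); nra.
Qed.

Lemma L2r_lin l a b f g : L2r l f -> L2r l g -> L2r l (fun x => a * f x + b * g x).
Proof.
move=> hf hg; have [mf fi] := hf; have [mg gi] := hg; split.
  by apply: measurable_funD; apply: measurable_funM.
have fgi := L2r_mul hf hg.
apply: eq_integrable (integrableD _ (integrableD _ (integrableZl _ (a ^+ 2) fi)
  (integrableZl _ (2 * a * b) fgi)) (integrableZl _ (b ^+ 2) gi)) => //.
by move=> x _; rewrite /= -!EFinM -!EFinD; congr EFin; ring.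
Qed.

Lemma L2r_le l c f g : measurable_fun `[l, +oo[ g ->
  (forall x, l <= x -> `|g x| <= c * `|f x|) -> L2r l f -> L2r l g.
Proof.
move=> mg gf [mf fi]; split => //.
apply: le_integrable (integrableZl _ (c ^+ 2) fi) => //.
  by apply/measurable_EFinP; exact: measurable_funX.
move=> x; rewrite /= in_itv/= andbT => lx; rewrite lee_fin.
rewrite -exprMn !normrX lerXn2r ?nnegrE// normrM.
by rewrite (le_trans (gf x lx))// ler_wpM2r// ler_norm.
Qed.

Lemma L2r_eq l f g : (forall x, l <= x -> f x = g x) -> L2r l f -> L2r l g.
Proof.
move=> fg [mf fi]; split.
  by apply: eq_measurable_fun mf => x; rewrite inE/= in_itv/= andbT => /fg.
by apply: eq_integrable fi => // x; rewrite inE/= in_itv/= andbT => /fg ->.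
Qed.

Lemma dot_eq l f g f' g' : (forall x, l <= x -> f x = f' x) ->
  (forall x, l <= x -> g x = g' x) -> dot l f g = dot l f' g'.
Proof.
move=> ff gg; apply: eq_Rintegral => x; rewrite inE/= in_itv/= andbT => lx.
by rewrite ff ?gg.
Qed.

Lemma dotC l f g : dot l f g = dot l g f.
Proof. by apply: eq_Rintegral => x _; rewrite mulrC. Qed.

Lemma dot_linl l a b f g h : L2r l f -> L2r l g -> L2r l h ->
  dot l (fun x => a * f x + b * g x) h = a * dot l f h + b * dot l g h.
Proof.
move=> hf hg hh; have fh := L2r_mul hf hh; have gh := L2r_mul hg hh.
rewrite /dot -!RintegralZl// -RintegralD//; [|exact: (integrableZl _ a fh)|
  exact: (integrableZl _ b gh)].
by apply: eq_Rintegral => x _; ring.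
Qed.

Lemma dot_linr l a b f g h : L2r l f -> L2r l g -> L2r l h ->
  dot l h (fun x => a * f x + b * g x) = a * dot l h f + b * dot l h g.
Proof. by move=> *; rewrite dotC dot_linl// !(dotC _ h). Qed.

Lemma dot_ge0 l f : 0 <= dot l f f.
Proof. by apply: Rintegral_ge0 => x _; rewrite -expr2 sqr_ge0. Qed.

Lemma dot_cauchy_schwarz l f g : L2r l f -> L2r l g ->
  dot l f g ^+ 2 <= dot l f f * dot l g g.
Proof.
move=> hf hg.
have H t : 0 <= dot l f f + 2 * t * dot l f g + t ^+ 2 * dot l g g.
  have hfg := L2r_lin 1 t hf hg.
  have := dot_ge0 l (fun x => 1 * f x + t * g x).
  rewrite dot_linl// !dot_linr// (dotC _ g f); lra.
have gg := dot_ge0 l g; have [g0|gn0] := eqVneq (dot l g g) 0.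
  have [->|fgn0] := eqVneq (dot l f g) 0; first by rewrite g0 mulr0 expr0n.
  (* When [dot l g g = 0] the quadratic [H] is affine in [t]; this [t] would give it the value
     -1. *)
  have := H (- (1 + dot l f f) / (2 * dot l f g)).
  rewrite g0 mulr0 addr0 (_ : 2 * _ * _ = - (1 + dot l f f)); last by field.
  lra.
have gp : 0 < dot l g g by rewrite lt_neqAle eq_sym gn0.
have := H (- dot l f g / dot l g g).
rewrite (_ : _ + _ = dot l f f - dot l f g ^+ 2 / dot l g g); last by field.
by rewrite subr_ge0 ler_pdivrMr.
Qed.

Lemma L2r_loc l f x : L2r l f -> mu.-integrable `[l, x] (EFin \o f).
Proof.
move=> [mf fi].
have sub : `[l, x]%classic `<=` `[l, +oo[ by apply: subset_itvl.
have f2 : mu.-integrable `[l, x] (EFin \o (fun x => f x ^+ 2)).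
  exact: integrableS fi.
have i1 : mu.-integrable `[l, x] (EFin \o (cst 1 : R -> R)).
  exact: integrable_cst_itv.
apply: le_integrable (integrableD _ i1 f2) => //.
  by apply/measurable_EFinP; exact: measurable_funS mf.
move=> t _ /=; rewrite lee_fin [leRHS]ger0_norm ?addr_ge0 ?sqr_ge0//.
have := real_normK (num_real (f t)); have := normr_ge0 (f t); nra.
Qed.

Lemma L2r_trunc l f (D : set R) : measurable D -> L2r l f -> L2r l (fun t => \1_D t * f t).
Proof.
move=> mD hf; have [mf fi] := hf; apply: (L2r_le (c := 1) _ _ hf).
  by apply: measurable_funM.
move=> t _; rewrite normrM ler_wpM2r// indicE; case: (_ \in _); by rewrite ?normr1 ?normr0.
Qed.

Lemma dot_trunc l f g a b : l <= a -> 
  dot l (fun t => \1_`[a, b] t * f t) g = Rintegral mu `[a, b] (fun t => f t * g t).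
Proof.
move=> la; rewrite -[in RHS](@setIidr _ `[l, +oo[ `[a, b]); last first.
  by apply: subset_itv; rewrite bnd_simp.
rewrite Rintegral_mkcondr; apply: eq_Rintegral => t _.
by rewrite patchE indicE; case: ifP; rewrite ?mul1r ?mul0r.
Qed.

(** Serves to make the pairing of a localized potential with a fixed [h] small: such a potential is
    bounded pointwise by a small multiple of [psi]. *)
Lemma dot_abs_le l c h f g : L2r l h -> L2r l f -> L2r l g -> 0 <= c ->
  (forall t, l <= t -> `|g t| <= c * `|f t|) ->
  `|dot l h g| <= c * Rintegral mu `[l, +oo[ (fun t => `|h t * f t|).
Proof.
move=> hh hf hg c0 gf; have hg' := L2r_mul hh hg; have hf' := L2r_mul hh hf.
apply: le_trans (le_normr_Rintegral _ hg') _ => //.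
rewrite -RintegralZl//; last exact: (integrable_norm hf').
apply: le_Rintegral => //; first exact: (integrable_norm hg').
  exact: (integrableZl _ c (integrable_norm hf')).
move=> t; rewrite /= in_itv/= andbT => lt.
by rewrite !normrM mulrCA ler_wpM2l// gf.
Qed.

(* Membership in H_+, with quasi-derivative dy and l(y) = f. *)
Definition Hp l q y dy f := [/\ ac l y dy, ac l dy (fun t => q t * y t - f t),
  L2r l y & L2r l f].

Lemma Hp_lin l q a b y dy f z dz g : Hp l q y dy f -> Hp l q z dz g ->
  Hp l q (fun x => a * y x + b * z x) (fun x => a * dy x + b * dz x)
    (fun x => a * f x + b * g x).
Proof.
move=> [y1 y2 y3 y4] [z1 z2 z3 z4]; split; [exact: ac_lin| |exact: L2r_lin..].
by apply: ac_eq (ac_lin a b y2 z2) _ _ => // x _; ring.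
Qed.

End Calculus.

(** * The Dirichlet problem at a negative spectral parameter *)

Section WeylPair.
Set Implicit Arguments. Unset Strict Implicit. Unset Printing Implicit Defensive.
Local Open Scope classical_set_scope.
Local Open Scope ring_scope.
Import numFieldNormedType.Exports.
Context {R : realType}.
Implicit Types (F G f g h y z : R -> R) (a b c e t eps : R).
Local Notation mu := (@lebesgue_measure R).

(* In the notation of the paper, phi is phi_1(., x) and psi is
   phi_2(., x) + m phi_1(., x), so m plays the role of m_oo(x). *)
Definition weyl_pair (l : R) (q : R -> R) (x m : R) (phi dphi psi dpsi : R -> R) :=
  [/\ ac l phi dphi, ac l dphi (fun t => q t * phi t - x * phi t),
      phi l = 0 /\ dphi l = 1, Hp l q psi dpsi (fun t => x * psi t)
    & psi l = -1 /\ dpsi l = m].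

Context {l : R} {q : R -> R} {x m : R} {phi dphi psi dpsi : R -> R}.
Context (wp : weyl_pair l q x m phi dphi psi dpsi).

(** Both functions solve the same equation, so the Wronskian has zero density; at [l] it equals
    [m * 0 - 1 * (-1)]. *)
Lemma wronskian1 t : l <= t -> dpsi t * phi t - dphi t * psi t = 1.
Proof.
case: wp => p1 p2 [p0 dp0] [s1 s2 s3 _] [s0 ds0] lt.
have hW := ac_lin 1 (-1) (ac_mul s2 p1) (ac_mul p2 s1).
have := ac0_const hW _ lt; rewrite s0 ds0 p0 dp0 => W.
rewrite -[RHS](_ : 1 * (m * 0) + -1 * (1 * -1) = 1); last by ring.
by rewrite -W => [|s _]; ring.
Qed.

(* Solves l(u) = x u + f with u(l) = 0 when f vanishes beyond e; beyond e it is a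
   multiple of psi, hence square integrable. *)
Definition green_fun e f t :=
  - (psi t * Rintegral mu `[l, t] (fun s => phi s * f s) +
     phi t * (Rintegral mu `[l, e] (fun s => psi s * f s)
              - Rintegral mu `[l, t] (fun s => psi s * f s))).

(** The terms that come from differentiating the integrals cancel, so only [psi] and [phi] are
    differentiated. *)
Definition dgreen_fun e f t :=
  - (dpsi t * Rintegral mu `[l, t] (fun s => phi s * f s) +
     dphi t * (Rintegral mu `[l, e] (fun s => psi s * f s)
              - Rintegral mu `[l, t] (fun s => psi s * f s))).

Lemma ac_mul_primitive F f h : ac l F f -> L2r l h ->
  ac l (fun t => Rintegral mu `[l, t] (fun s => F s * h s)) (fun s => F s * h s).
Proof.
move=> hF hh; apply: ac_primitive => t lt.
apply: eq_integrable (ac_mul_integrable hF lt (L2r_loc t hh)) => // s _.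
by rewrite /= mulrC.
Qed.

Lemma green_fun_support e f t : L2r l f -> (forall t, e < t -> f t = 0) ->
  l <= e -> e <= t ->
  green_fun e f t = - (psi t * Rintegral mu `[l, e] (fun s => phi s * f s)).
Proof.
case: wp => p1 _ _ [s1 _ _ _] _ hf f0 le et.
have lt := le_trans le et.
have [pi _] := ac_mul_primitive p1 hf lt; have [si _] := ac_mul_primitive s1 hf lt.
rewrite /green_fun !(@Rintegral_support _ l e t)//; first ring.
  by move=> s /f0 ->; rewrite mulr0.
by move=> s /f0 ->; rewrite mulr0.
Qed.

(** Variation of parameters. The sign of the boundary derivative is what lets [localized] prescribe
    a unit slope at [l]. *)
Lemma green_funP e f : l <= e -> L2r l f -> (forall t, e < t -> f t = 0) ->
  [/\ Hp l q (green_fun e f) (dgreen_fun e f) (fun t => x * green_fun e f t + f t),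
      green_fun e f l = 0 &
      dgreen_fun e f l = - Rintegral mu `[l, e] (fun s => psi s * f s)].
Proof.
move=> le hf f0; case: (wp) => p1 p2 [p0 dp0] [s1 s2 s3 _] [s0 ds0].
have hP := ac_mul_primitive p1 hf; have hS := ac_mul_primitive s1 hf.
set K := Rintegral mu `[l, e] (fun s => psi s * f s).
have hK := ac_lin K (-1) (@ac_cst R l 1) hS.
have a1 : ac l (green_fun e f) (dgreen_fun e f).
  apply: ac_eq (ac_lin (-1) (-1) (ac_mul s1 hP) (ac_mul p1 hK)) _ _ => t lt.
    by rewrite /green_fun -/K /=; ring.
  by rewrite /dgreen_fun -/K /=; ring.
have a2 : ac l (dgreen_fun e f)
    (fun t => q t * green_fun e f t - (x * green_fun e f t + f t)).
  apply: ac_eq (ac_lin (-1) (-1) (ac_mul s2 hP) (ac_mul p2 hK)) _ _ => t lt.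
    by rewrite /dgreen_fun -/K /=; ring.
  (* Differentiating once more leaves [f] multiplied by the Wronskian, which is 1. *)
  transitivity (q t * green_fun e f t -
    (x * green_fun e f t + f t * (dpsi t * phi t - dphi t * psi t))).
    by rewrite /green_fun -/K /=; ring.
  by rewrite wronskian1// mulr1.
have mu' := ac_measurable a1.
have L2u : L2r l (green_fun e f).
  split => //.
  (* Integrable majorant of the square: the constant [B ^+ 2] on [[l, e]], and [A ^+ 2 * psi ^+ 2]
     beyond [e]. *)
  set A := Rintegral mu `[l, e] (fun s => phi s * f s).
  set B := `|green_fun e f l| + Rintegral mu `[l, e] (fun s => `|dgreen_fun e f s|).
  have i1 : mu.-integrable `[l, +oo[ (EFin \o \1_`[l, e]).
    exact: integrableS (integrable_indic_itv l e true false).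
  have [_ i2] := s3.
  apply: le_integrable (integrableD _ (integrableZl _ (B ^+ 2) i1)
    (integrableZl _ (A ^+ 2) i2)) => //.
    by apply/measurable_EFinP; exact: measurable_funX.
  move=> t; rewrite /= in_itv/= andbT => lt.
  rewrite lee_fin normrX [leRHS]ger0_norm; last first.
    by rewrite addr_ge0// mulr_ge0 ?sqr_ge0.
  have [te|et] := leP t e.
    rewrite indicE mem_set ?mulr1; last by rewrite /= in_itv/= lt.
    rewrite -[leLHS]addr0; apply: lerD; last by rewrite mulr_ge0 ?sqr_ge0.
    rewrite lerXn2r ?nnegrE//.
      by rewrite /B addr_ge0// Rintegral_ge0.
    by apply: (ac_norm_le a1 le); rewrite lt.
  rewrite indicE memNset ?mulr0 ?add0r; last first.
    by rewrite /= in_itv/= lt leNgt et.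
  rewrite real_normK ?num_real// (green_fun_support hf f0 le (ltW et)) -/A.
  by rewrite sqrrN exprMn mulrC.
split.
- by split => //; have := L2r_lin x 1 L2u hf; apply: L2r_eq => t _; rewrite mul1r.
- by rewrite /green_fun set_itv1 !Rintegral_set1 s0 p0; ring.
- by rewrite /dgreen_fun set_itv1 !Rintegral_set1 ds0 dp0 -/K; ring.
Qed.

(* The Green potential of c psi on a short interval [l, e], with c normalising
   g'(l) = 1. Since f is close to a unit mass at l, (f, u) is close to u(l). *)
Lemma localized u du (eta : R) : ac l u du -> L2r l u -> 0 < eta -> eta <= 2^-1 ->
  exists g dg f, [/\ Hp l q g dg (fun t => x * g t + f t), L2r l f,
    g l = 0 /\ dg l = 1, dot l f psi = -1 &
    [/\ forall t, l <= t -> `|g t| <= 38 * eta * `|psi t|,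
        `|dot l f g| <= 114 * eta & `|dot l f u - u l| <= 6 * eta]].
Proof.
move=> hu L2u e0 e1; case: (wp) => p1 p2 [p0 dp0] [s1 s2 s3 _] [s0 ds0].
have [d1 d10 psi_near] := ac_right_continuous s1 e0.
have [d2 d20 phi_near] := ac_right_continuous p1 e0.
(* The function [u + u(l) psi] vanishes at [l] because [psi l = -1]. Since [dot l f psi] will be -1,
   pairing it with [f] yields exactly the error [dot l f u - u l]. *)
have hv := ac_lin 1 (u l) hu s1.
have [d3 d30 u_near] := ac_right_continuous hv e0.
pose d := Num.min d1 (Num.min d2 d3).
have d0 : 0 < d by rewrite /d !lt_min d10 d20.
pose e := l + d; have le : l <= e by rewrite lerDl ltW.
have near t : l <= t <= e -> [/\ -(3/2) <= psi t <= -(1/2), `|phi t| <= eta &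
    `|u t + u l * psi t| <= eta].
  case/andP=> lt te.
  have td1 : l <= t <= l + d1.
    by rewrite lt (le_trans te)// lerD2l /d ge_min lexx.
  have td2 : l <= t <= l + d2.
    by rewrite lt (le_trans te)// lerD2l /d !ge_min lexx orbT.
  have td3 : l <= t <= l + d3.
    by rewrite lt (le_trans te)// lerD2l /d !ge_min lexx !orbT.
  split.
  - have := psi_near t td1; rewrite s0 ler_norml; lra.
  - by have := phi_near t td2; rewrite p0 subr0.
  - have := u_near t td3; rewrite s0.
    by rewrite (_ : 1 * u t + _ - _ = u t + u l * psi t)//; ring.
have sub t : t <= e -> `[l, t]%classic `<=` `[l, e].
  by move=> te; apply: subset_itvl; rewrite bnd_simp.
have ei : e - l = d by rewrite /e; ring.
pose intpsi F := forall t, mu.-integrable `[l, t] (EFin \o (fun s => psi s * F s)).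
have intphi : intpsi phi.
  move=> t; have [lt|tl] := leP l t; last by rewrite set_itv_ge ?integrable_set0// bnd_simp -ltNge.
  exact: ac_mul_integrable p1 lt (L2r_loc t s3).
have int2 F : L2r l F -> intpsi F.
  move=> hF t; apply: integrableS (L2r_mul s3 hF) => //.
  by apply: subset_itvl.
pose I := Rintegral mu `[l, e] (fun s => psi s * psi s).
(* On [[l, e]] the square of [psi] is at least 1/4, because [eta <= 1/2] keeps [psi] within 1/2 of
   -1. *)
have I1 : d <= 4 * I.
  rewrite -[d]mul1r -ei /I.
  have <- : Rintegral mu `[l, e] (cst 1) = 1 * (e - l).
    rewrite Rintegral_cst//= lebesgue_measure_itv/= lte_fin.
    by rewrite /e ltrDl d0.
  rewrite -RintegralZl ?int2//; apply: le_Rintegral => //.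
  - exact: integrable_cst_itv.
  - exact: (integrableZl _ 4 (int2 _ s3 e)).
  - by move=> t; rewrite /= in_itv/= => /near[? _ _]; nra.
have I0 : 0 < I by lra.
(* This makes the integral of [psi * f] equal to -1, hence [g'(l) = 1] by [green_funP]. *)
pose c := - I^-1.
have cb : `|c| * d <= 4.
  by rewrite /c normrN gtr0_norm ?invr_gt0// mulrC ler_pdivrMr.
pose f := fun t => \1_`[l, e] t * (c * psi t).
have hcpsi : L2r l (fun t => c * psi t).
  by apply: L2r_eq (L2r_lin c 0 s3 s3) => t _; ring.
have hf : L2r l f by apply: L2r_trunc.
have fout t : e < t -> f t = 0.
  by move=> et; rewrite /f indicE memNset ?mul0r//= in_itv/= (leNgt t e) et andbF.
have fin t : l <= t <= e -> f t = c * psi t.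
  by move=> te; rewrite /f indicE mem_set ?mul1r.
have dotf F : L2r l F -> dot l f F = c * Rintegral mu `[l, e] (fun s => psi s * F s).
  move=> hF; rewrite dot_trunc// -RintegralZl ?int2//.
  by apply: eq_Rintegral => s _; rewrite mulrA.
(* The constant is [6 = 3/2 * 4], from [|psi| <= 3/2] and [|c| * d <= 4]. *)
have bnd F k t : intpsi F -> 0 <= k -> (forall s, l <= s <= e -> `|F s| <= k) ->
    l <= t <= e -> `|c * Rintegral mu `[l, t] (fun s => psi s * F s)| <= 6 * k.
  move=> hF k0 Fk /andP[lt te]; rewrite normrM.
  have h : `|Rintegral mu `[l, t] (fun s => psi s * F s)| <= (3 / 2 * k) * (t - l).
    apply: Rintegral_abs_le => [//||]; first exact: hF.
    move=> s /andP[ls st]; have se : l <= s <= e by rewrite ls (le_trans st).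
    rewrite normrM ler_pM//; last exact: Fk.
    by have [? _ _] := near s se; rewrite ler_norml; lra.
  have td : t - l <= d by rewrite -ei lerD2r.
  apply: (@le_trans _ _ (`|c| * (3 / 2 * k * d))).
    by apply: ler_wpM2l => //; apply: le_trans h _; apply: ler_wpM2l => //; rewrite mulr_ge0.
  rewrite [leLHS](_ : _ = 3 / 2 * k * (`|c| * d)); last by rewrite mulrCA.
  apply: (@le_trans _ _ (3 / 2 * k * 4)); last lra.
  by apply: ler_wpM2l => //; rewrite mulr_ge0.
have K1 : dot l f psi = -1 by rewrite dotf// -/I /c mulNr mulVf ?gt_eqF.
have [hg g0 dg0] := green_funP le hf fout.
have [gg1 _ gg3 _] := hg.
have sf F t : intpsi F -> l <= t <= e -> Rintegral mu `[l, t] (fun s => F s * f s) =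
    c * Rintegral mu `[l, t] (fun s => psi s * F s).
  move=> hF /andP[lt te]; rewrite -RintegralZl//.
  apply: eq_Rintegral => s; rewrite inE/= in_itv/= => /andP[ls st].
  by rewrite fin ?ls ?(le_trans st)//; ring.
have ee : l <= e <= e by rewrite le lexx.
have KK : Rintegral mu `[l, e] (fun s => psi s * f s) = -1.
  by rewrite (sf psi _ (int2 _ s3) ee) -(dotf psi s3).
(* The first Green term is at most [3/2 * (6 * eta)]. The second is at most [eta * (1 + 9)], where 1
   is the normalisation [KK] and 9 bounds the integral of [psi * f] up to [t]. *)
have gb t : l <= t <= e -> `|green_fun e f t| <= 19 * eta.
  move=> /[dup] te /andP[lt te']; have [ps ph _] := near t te.
  rewrite /green_fun KK (sf phi _ intphi te) (sf psi _ (int2 _ s3) te).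
  have Pb := bnd phi eta t intphi (ltW e0) (fun s se => let: And3 _ h _ := near s se in h) te.
  have S0 := bnd psi (3/2) t (int2 _ s3) _ _ te.
  have /ler_normlP[S1 S2] : `|c * Rintegral mu `[l, t] (fun s => psi s * psi s)| <= 6 * (3/2).
    apply: S0 => [|s se]; first lra.
    by have [? _ _] := near s se; rewrite ler_norml; lra.
  rewrite normrN (le_trans (ler_normD _ _))//.
  rewrite (_ : 19 * eta = 3 / 2 * (6 * eta) + eta * 10); last by field.
  apply: lerD; rewrite normrM; apply: ler_pM; rewrite ?normr_ge0//.
    by rewrite ler_norml; lra.
  by rewrite ler_norml; lra.
exists (green_fun e f), (dgreen_fun e f), f.
split=> //; first by rewrite dg0 KK opprK.
split.
(* On [[l, e]], [|psi| >= 1/2] turns 19 into 38; beyond [e] the potential is a multiple of [psi]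
   with coefficient at most [6 * eta]. *)
- move=> t lt; have [te|et] := leP t e.
    have te2 : l <= t <= e by rewrite lt.
    apply: le_trans (gb t te2) _; have [ps _ _] := near t te2.
    rewrite -[19 * eta](_ : 38 * eta * (1 / 2) = _); last by field.
    apply: ler_wpM2l; first by rewrite mulr_ge0// ltW.
    by rewrite ler_normr; apply/orP; right; lra.
  rewrite (green_fun_support hf fout le (ltW et)) normrN normrM mulrC.
  apply: ler_wpM2r => //; rewrite sf//.
  apply: le_trans (bnd phi eta e intphi (ltW e0) (fun s se => let: And3 _ h _ := near s se in h) ee) _.
  by apply: ler_wpM2r; [exact: ltW|lra].
- rewrite dotf// (_ : 114 * eta = 6 * (19 * eta)); last by ring.
  by apply: bnd => //; [exact: int2|rewrite mulr_ge0// ltW].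
- have hw : L2r l (fun t => 1 * u t + u l * psi t) by exact: L2r_lin.
  have -> : dot l f u - u l = c * Rintegral mu `[l, e] (fun s => psi s * (1 * u s + u l * psi s)).
    by rewrite -dotf// dot_linr// K1; ring.
  apply: bnd => //; [exact: int2|exact: ltW|].
  by move=> s se; rewrite mul1r; have [] := near s se.
Qed.

(** * Upper and lower bounds for the Dirichlet form *)

Context (x0 : x < 0).

(** For [y = - a psi + b' g] one has [l(y) = x y + b' f], and the energy is
    [m a^2 + x |y|^2 + b'^2 (f, g)]. In [x |y|^2] the two squares contribute non-positive terms; the
    cross term and [(f, g)] are of order [eta]. *)
Lemma near_minimizer a b eps : 0 < eps ->
  exists y dy f, [/\ Hp l q y dy f, y l = a, dy l = b &
    dot l f y - a * b <= m * a ^+ 2 + eps].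
Proof.
move=> eps0; case: (wp) => _ _ _ /[dup] hs [s1 s2 s3 s4] [s0 ds0].
(* The derivative of [- a psi] at [l] is [- a m], so the localized part must supply the slope
   [b + a m]. *)
pose b' := b + a * m.
pose C := 38 * Rintegral mu `[l, +oo[ (fun t => `|psi t * psi t|).
pose M := `|2 * a * b' * x| * C + b' ^+ 2 * 114.
have C0 : 0 <= C by rewrite mulr_ge0// Rintegral_ge0.
have M0 : 0 <= M by rewrite /M addr_ge0// mulr_ge0// sqr_ge0.
(* [M * eta] bounds the total error; [M + 1] keeps the quotient defined when [M = 0]. *)
pose eta := Num.min 2^-1 (eps / (M + 1)).
have e0 : 0 < eta by rewrite /eta lt_min invr_gt0 divr_gt0//= ?ltr_wpDl.
have e1 : eta <= 2^-1 by rewrite /eta ge_min lexx.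
have e2 : M * eta <= eps.
  apply: (@le_trans _ _ (M * (eps / (M + 1)))).
    by apply: ler_wpM2l => //; rewrite /eta ge_min lexx orbT.
  rewrite mulrCA -[leRHS]mulr1 ler_wpM2l//; first exact: ltW.
  by rewrite ler_pdivrMr ?mul1r ?lerDl// ltr_wpDl.
have [g [dg [f [hg hf [gl dgl] fpsi [gb fg _]]]]] := localized s1 s3 e0 e1.
have [_ _ g3 g4] := hg.
exists (fun t => (- a) * psi t + b' * g t), (fun t => (- a) * dpsi t + b' * dg t),
  (fun t => (- a) * (x * psi t) + b' * (x * g t + f t)); split.
- exact: Hp_lin.
- by rewrite s0 gl; ring.
- by rewrite ds0 dgl /b'; ring.
have cg : 0 <= 38 * eta by rewrite mulr_ge0// ltW.
have B := dot_abs_le s3 s3 g3 cg gb.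
have y3 : L2r l (fun t => (- a) * psi t + b' * g t) by exact: L2r_lin.
have spsi k : L2r l k -> dot l (fun t => x * psi t) k = x * dot l psi k.
  move=> hk; have := dot_linl x 0 s3 s3 hk; rewrite mul0r addr0 => <-.
  by apply: dot_eq => // t _; ring.
have gE w : L2r l w -> dot l (fun t => x * g t + f t) w = x * dot l g w + dot l f w.
  move=> hw; rewrite -[dot l f w]mul1r -dot_linl//.
  by apply: dot_eq => // t _; rewrite mul1r.
rewrite (dot_linl (- a) b' s4 g4 y3) (spsi _ y3) (gE _ y3).
rewrite !(dot_linr (- a) b' s3 g3)// fpsi (dotC l g psi).
have P0 := dot_ge0 l psi; have G0 := dot_ge0 l g.
move: B P0 G0 fg; set A1 := dot l psi g; set A2 := dot l f g.
set P := dot l psi psi; set G := dot l g g => B P0 G0 fg.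
have n1 := ler_norm (- (2 * a * b' * x * A1)); rewrite normrN normrM in n1.
have n2 := ler_wpM2l (normr_ge0 (2 * a * b' * x)) B.
have n3 := ler_wpM2l (sqr_ge0 b') (le_trans (ler_norm _) fg).
have n4 : a ^+ 2 * (x * P) <= 0 by rewrite mulr_ge0_le0 ?sqr_ge0// mulr_le0_ge0// ltW.
have n5 : b' ^+ 2 * (x * G) <= 0 by rewrite mulr_ge0_le0 ?sqr_ge0// mulr_le0_ge0// ltW.
have n6 : `|2 * a * b' * x| * (C * eta) + b' ^+ 2 * (114 * eta) <= eps.
  by rewrite (_ : _ + _ = M * eta) // /M; ring.
have n2' : `|2 * a * b' * x| * `|A1| <= `|2 * a * b' * x| * (C * eta).
  by apply: le_trans n2 _; rewrite /C (mulrAC 38 _ eta) lexx.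
have -> : b = b' - a * m by rewrite /b'; ring.
lra.
Qed.

Context (min0 : forall y dy f, Hp l q y dy f -> y l = 0 -> dy l = 0 -> 0 <= dot l f y).

(** Subtracting [u'(l) g] from [u], with [g] localized, gives an element of the minimal domain.
    Letting [eta] tend to 0 removes every correction: [(f, u)] is small because [u l = 0], and the
    term in [x |g|^2] has a favourable sign. *)
Lemma dirichlet_ge0 u du fu : Hp l q u du fu -> u l = 0 -> 0 <= dot l fu u.
Proof.
move=> /[dup] hu [u1 u2 u3 u4] ul; have [_ _ _ [_ _ s3 _] _] := wp.
set b := du l.
pose N h := 38 * Rintegral mu `[l, +oo[ (fun t => `|h t * psi t|).
rewrite -oppr_le0; apply: (@le0_of_eps R _
  (`|b| * N fu + `|b * x| * N u + 6 * `|b| + 114 * b ^+ 2)) => eta e0 e1.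
have [g [dg [f [hg hf [gl dgl] fpsi [gb fg fu']]]]] := localized u1 u3 e0 e1.
have [_ _ g3 _] := hg.
have c0 : 0 <= 38 * eta by rewrite mulr_ge0// ltW.
have B h : L2r l h -> `|dot l h g| <= N h * eta.
  move=> hh; by have := dot_abs_le hh s3 g3 c0 gb; rewrite /N mulrAC.
have hv := Hp_lin 1 (- b) hu hg.
have hv0 := min0 hv; rewrite /= ul gl dgl -/b in hv0.
have xg : L2r l (fun t => x * g t + f t).
  by have := L2r_lin x 1 g3 hf; apply: L2r_eq => t _; rewrite mul1r.
have E w : L2r l w -> dot l (fun t => x * g t + f t) w = x * dot l g w + dot l f w.
  move=> hw; rewrite -[dot l f w]mul1r -dot_linl//.
  by apply: dot_eq => // t _; rewrite mul1r.
move: hv0 => /(_ ltac:(ring) ltac:(ring)).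
rewrite dot_linl//; last exact: L2r_lin.
rewrite !dot_linr// !E// (dotC _ g u).
have gg := dot_ge0 l g.
move: fu'; rewrite ul subr0.
have := B _ u3; have := B _ u4.
set A1 := dot l fu g; set A2 := dot l u g; set A3 := dot l f u; move: fg; set A4 := dot l f g.
move=> k4 k1 k2 k3 k0.
have n1 := ler_norm (- (b * A1)); rewrite normrN normrM in n1.
have n2 := ler_norm (- (b * x * A2)); rewrite normrN normrM in n2.
have n3 := ler_norm (- (b * A3)); rewrite normrN normrM in n3.
have n4 := ler_norm A4.
have b0 := normr_ge0 b; have b1 := normr_ge0 (b * x).
have m1 := ler_wpM2l b0 k1; have m2 := ler_wpM2l b1 k2; have m3 := ler_wpM2l b0 k3.
have m4 := ler_wpM2l (sqr_ge0 b) (le_trans n4 k4).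
have m5 : b ^+ 2 * (x * dot l g g) <= 0.
  by rewrite mulr_ge0_le0 ?sqr_ge0// mulr_le0_ge0// ltW.
lra.
Qed.

(** Provides an interval on which pairing with [psi] detects a multiple of [phi]; [green_identity]
    reads off its defect there. Near [l], [psi] is close to -1 and [phi] is at least [(t - l) / 2];
    the right half of the interval keeps [phi] away from 0. *)
Lemma phi_psi_test : exists a e, [/\ l <= a, a <= e &
  Rintegral mu `[a, e] (fun t => psi t * phi t) < 0].
Proof.
case: (wp) => p1 p2 [p0 dp0] [s1 s2 s3 _] [s0 ds0].
have h2 : 0 < 2^-1 :> R by rewrite invr_gt0.
have [d1 d10 psi_near] := ac_right_continuous s1 h2.
have [d2 d20 dphi_near] := ac_right_continuous p2 h2.
pose d := Num.min d1 d2.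
have d0 : 0 < d by rewrite /d lt_min d10 d20.
have dd1 : d <= d1 by rewrite /d ge_min lexx.
have dd2 : d <= d2 by rewrite /d ge_min lexx orbT.
move: d d0 dd1 dd2 => d d0 dd1 dd2.
exists (l + d / 2), (l + d).
have dl : l <= l + d / 2 by lra.
have de : l + d / 2 <= l + d by lra.
split => //.
have phige t : l <= t <= l + d -> 2^-1 * (t - l) <= phi t.
  move=> /andP[lt td]; have [pi ->] := p1 t lt; rewrite p0 add0r.
  apply: Rintegral_ge_cst => // s /andP[ls st].
  have sd : l <= s <= l + d2 by rewrite ls; lra.
  by have := dphi_near s sd; rewrite dp0 ler_norml; lra.
have ipp : mu.-integrable `[l + d / 2, l + d] (EFin \o (fun t => psi t * phi t)).
  apply: integrableS (ac_mul_integrable p1 (_ : l <= l + d) (L2r_loc _ s3)) => //; last lra.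
  by apply: subset_itvr; rewrite bnd_simp.
have ipn : mu.-integrable `[l + d / 2, l + d] (EFin \o (fun t => (-1) * (psi t * phi t))).
  exact: (integrableZl _ (-1) ipp).
have := Rintegral_ge_cst (c := 8^-1 * d) de ipn.
rewrite RintegralZl// => H.
have {}H : 8^-1 * d * (l + d - (l + d / 2)) <=
    -1 * Rintegral mu `[l + d / 2, l + d] (fun t => psi t * phi t).
  apply: H => t /andP[t1 t2].
  have tl : l <= t <= l + d by rewrite t2 andbT; lra.
  have tl1 : l <= t <= l + d1 by lra.
  have := phige t tl; have := psi_near t tl1; rewrite s0 ler_norml.
  set P := phi t; set Q := psi t => h h'.
  have q1 : 2^-1 <= - Q by lra.
  have q2 : 4^-1 * d <= P by lra.
  have : 2^-1 * (4^-1 * d) <= (- Q) * P by apply: ler_pM => //; lra.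
  lra.
have dp : 0 < 8^-1 * d * (l + d - (l + d / 2)) by apply: mulr_gt0; lra.
lra.
Qed.

(* Formally this is Green's formula with no boundary term at infinity. Cut
   f = l(u) - x u off at N and subtract from u the corresponding Green potential:
   the difference v is W phi on [l, N], where W is the defect of the identity, and
   positivity bounds its L2 norm by that of the tail of f. *)
Lemma green_identity u du fu : Hp l q u du fu -> u l = 0 ->
  du l = - dot l psi (fun t => 1 * fu t + (- x) * u t).
Proof.
move=> /[dup] hu [u1 u2 u3 u4] ul; case: (wp) => p1 p2 [p0 dp0] [s1 s2 s3 _] [s0 ds0].
have [a [e [la ae c1]]] := phi_psi_test; set C1 := Rintegral _ _ _ in c1.
set f := fun t => 1 * fu t + (- x) * u t.
have hf : L2r l f by exact: L2r_lin.
pose h t := \1_`[a, e] t * psi t.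
have hh : L2r l h by apply: L2r_trunc.
apply/eqP; rewrite -subr_eq0 opprK -sqrf_eq0 eq_le sqr_ge0 andbT.
(* From [W ^+ 2 * C1 ^+ 2 <= (h, h) (v, v)] and [x ^+ 2 * (v, v) <= (r, r) <= eps]. *)
pose K := dot l h h / (x ^+ 2 * C1 ^+ 2).
apply: (@le0_of_eps R _ (2 * K + 2)) => eps e0 e1.
have [N1 lN1 t1] := integrable_tail (L2r_mul s3 hf) e0.
have [N2 lN2 t2] := integrable_tail (L2r_mul hf hf) e0.
(* [N] lies beyond both tails and beyond the test interval [[a, e]]. *)
pose N := Num.max e (Num.max N1 N2).
have eN : e <= N by rewrite /N le_max lexx.
have {}t1 := t1 N ltac:(by rewrite /N !le_max lexx orbT).
have {}t2 := t2 N ltac:(by rewrite /N !le_max lexx !orbT).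
move: N eN t1 t2 => N eN t1 t2.
have le : l <= e by exact: le_trans ae.
have lN : l <= N by exact: le_trans eN.
pose fN t := \1_`[l, N] t * f t.
have hfN : L2r l fN by apply: L2r_trunc.
have fNout t : N < t -> fN t = 0.
  by move=> Nt; rewrite /fN indicE memNset ?mul0r//= in_itv/= (leNgt t N) Nt andbF.
have fNin t : l <= t <= N -> fN t = f t.
  by move=> tN; rewrite /fN indicE mem_set ?mul1r.
have [hg g0 dg0] := green_funP lN hfN fNout.
have [_ _ g3 g4] := hg.
set w := green_fun N fN in hg g0 g3 g4.
have hv := Hp_lin 1 (-1) hu hg.
pose v t := 1 * u t + -1 * w t.
have v3 : L2r l v by exact: L2r_lin.
pose r t := 1 * f t + -1 * fN t.
have r3 : L2r l r by exact: L2r_lin.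
set W := du l + Rintegral mu `[l, N] (fun s => psi s * f s).
(* Green's formula on [[l, t]] expresses the integrals of [phi * f] and [psi * f] through boundary
   values of [u]; the Wronskian identity then cancels [u t]. *)
have vphi t : l <= t <= N -> v t = W * phi t.
  move=> /andP[lt tN].
  have sub (k : R -> R) : Rintegral mu `[l, t] (fun s => k s * fN s) =
      Rintegral mu `[l, t] (fun s => k s * f s).
    apply: eq_Rintegral => s; rewrite inE/= in_itv/= => /andP[ls st].
    by rewrite fNin// ls (le_trans st).
  have subN : Rintegral mu `[l, N] (fun s => psi s * fN s) =
      Rintegral mu `[l, N] (fun s => psi s * f s).
    apply: eq_Rintegral => s; rewrite inE/= in_itv/= => /andP[ls st].
    by rewrite fNin// ls.
  have A1 : ac l (fun t => u t * dpsi t - du t * psi t) (fun t => psi t * f t).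
    apply: ac_eq (ac_lin 1 (-1) (ac_mul u1 s2) (ac_mul u2 s1)) _ _ => s _; first by ring.
    by rewrite /f; ring.
  have A2 : ac l (fun t => u t * dphi t - du t * phi t) (fun t => phi t * f t).
    apply: ac_eq (ac_lin 1 (-1) (ac_mul u1 p2) (ac_mul u2 p1)) _ _ => s _; first by ring.
    by rewrite /f; ring.
  have [_] := A1 t lt; have [_] := A2 t lt.
  rewrite ul s0 ds0 p0 dp0 => E2 E1.
  have := wronskian1 lt => Wr.
  rewrite /v /w /green_fun !sub subN.
  have -> : Rintegral mu `[l, t] (fun s => phi s * f s) = u t * dphi t - du t * phi t.
    by rewrite E2; ring.
  have -> : Rintegral mu `[l, t] (fun s => psi s * f s) = u t * dpsi t - du t * psi t - du l.
    by rewrite E1; ring.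
  rewrite /W; set S := Rintegral _ _ _.
  transitivity (u t * (1 - (dpsi t * phi t - dphi t * psi t)) + (du l + S) * phi t).
    by ring.
  by rewrite Wr; ring.
(* Here [v l = 0] and [l(v) = x v + r], so [dirichlet_ge0] applies to [v]. *)
have dir : 0 <= x * dot l v v + dot l r v.
  have := dirichlet_ge0 hv; rewrite /= ul g0 => /(_ ltac:(ring)).
  rewrite -[dot l r v]mul1r -dot_linl//; congr (_ <= _).
  by apply: dot_eq => // t _; rewrite /v /r /f; ring.
have rr : dot l r r <= eps.
  have q1 : dot l fN f = Rintegral mu `[l, N] (fun s => f s * f s) by rewrite dot_trunc.
  have q2 : dot l fN fN = Rintegral mu `[l, N] (fun s => f s * f s).
    rewrite dot_trunc//; apply: eq_Rintegral => s; rewrite inE/= in_itv/= => sN.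
    by rewrite fNin.
  have := t2; rewrite -/(dot l f f) ler_norml => /andP[_].
  have rE k : L2r l k -> dot l r k = 1 * dot l f k + -1 * dot l fN k.
    by move=> hk; exact: dot_linl.
  have rE' k : L2r l k -> dot l k r = 1 * dot l k f + -1 * dot l k fN.
    by move=> hk; exact: dot_linr.
  rewrite (rE _ r3) (rE' _ hf) (rE' _ hfN) (dotC l f fN) q1 q2.
  set Q := Rintegral _ _ _; lra.
have cs1 := dot_cauchy_schwarz r3 v3.
have cs2 := dot_cauchy_schwarz hh v3.
(* [h] is supported in [[a, e]], where [v = W phi]. *)
have hv' : dot l h v = W * C1.
  rewrite dot_trunc// -RintegralZl//; last first.
    apply: integrableS (ac_mul_integrable p1 le (L2r_loc _ s3)) => //.
    by apply: subset_itvr; rewrite bnd_simp.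
  apply: eq_Rintegral => s; rewrite inE/= in_itv/= => /andP[as_ se].
  have sN : l <= s <= N by rewrite (le_trans la as_) (le_trans se eN).
  by rewrite vphi//; ring.
have vv := dot_ge0 l v; have hh0 := dot_ge0 l h; have rr0 := dot_ge0 l r.
(* Combine [- x (v, v) <= (r, v)] with Cauchy-Schwarz and cancel one factor [(v, v)]. *)
have xv : x ^+ 2 * dot l v v <= dot l r r.
  have [->|vn] := eqVneq (dot l v v) 0; first by rewrite mulr0.
  have vp : 0 < dot l v v by rewrite lt_neqAle eq_sym vn.
  rewrite -(ler_pM2r vp); apply: le_trans cs1.
  have s1' : 0 <= - x * dot l v v by rewrite mulr_ge0// oppr_ge0 ltW.
  have s2' : - x * dot l v v <= dot l r v by rewrite mulNr -subr_ge0 opprK addrC.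
  have : (- x * dot l v v) ^+ 2 <= dot l r v ^+ 2 by rewrite lerXn2r// nnegrE ?(le_trans s1').
  by apply: le_trans; rewrite exprMn sqrrN expr2 (expr2 (dot l v v)) mulrA.
have x2 : 0 < x ^+ 2 by rewrite exprn_even_gt0//= lt_eqF.
have C2 : 0 < C1 ^+ 2 by rewrite exprn_even_gt0//= lt_eqF.
have WK : W ^+ 2 <= K * eps.
  rewrite /K mulrAC ler_pdivlMr; last exact: mulr_gt0.
  rewrite hv' exprMn in cs2.
  rewrite mulrCA; apply: (@le_trans _ _ (x ^+ 2 * (dot l h h * dot l v v))).
    by apply: ler_wpM2l => //; exact: ltW.
  by rewrite mulrCA; apply: ler_wpM2l => //; exact: le_trans rr.
have -> : du l + dot l psi f = W + (dot l psi f - Rintegral mu `[l, N] (fun s => psi s * f s)).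
  by rewrite /W; ring.
move: t1; rewrite -/(dot l psi f); set D := dot l psi f - _ => t1.
have D2 : D ^+ 2 <= eps ^+ 2.
  by rewrite -[D ^+ 2]real_normK ?num_real// lerXn2r ?nnegrE// ltW.
have ee : eps ^+ 2 <= eps by rewrite expr2 -[leRHS]mulr1 ler_wpM2l//; lra.
have WD := sqr_ge0 (W - D).
have -> : (W + D) ^+ 2 = 2 * W ^+ 2 + 2 * D ^+ 2 - (W - D) ^+ 2 by ring.
apply: (@le_trans _ _ (2 * (K * eps) + 2 * eps)); first lra.
by rewrite le_eqVlt; apply/orP; left; apply/eqP; ring.
Qed.

(** Put [u = y + y(l) psi], which vanishes at [l]. By [green_identity], the right side exceeds the
    left by [(l(u), u) - x |u|^2], and both terms of this are non-negative. *)
Lemma energy_ge y dy f : Hp l q y dy f ->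
  m * y l ^+ 2 + x * dot l y y <= dot l f y - y l * dy l.
Proof.
move=> /[dup] hy [y1 y2 y3 y4]; case: (wp) => _ _ _ /[dup] hs [s1 s2 s3 s4] [s0 ds0].
set a := y l; have hu := Hp_lin 1 a hy hs.
have ul : 1 * y l + a * psi l = 0 by rewrite s0 -/a; ring.
have [_ _ u3 _] := hu.
have spsi k : L2r l k -> dot l (fun t => x * psi t) k = x * dot l psi k.
  move=> hk; have := dot_linl x 0 s3 s3 hk; rewrite mul0r addr0 => <-.
  by apply: dot_eq => // t _; ring.
have k1 : 0 <= dot l (fun t => 1 * y t + a * psi t) (fun t => 1 * y t + a * psi t).
  exact: dot_ge0.
rewrite (dot_linl 1 a y3 s3 u3) (dot_linr 1 a y3 s3 y3) (dot_linr 1 a y3 s3 s3)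
  (dotC l y psi) in k1.
have k2 := green_identity hu ul.
(* In [l(u) - x u] the contributions of [psi] cancel, since [l(psi) = x psi]. *)
have E2 : dot l psi (fun t => 1 * (1 * f t + a * (x * psi t)) +
    (- x) * (1 * y t + a * psi t)) = 1 * dot l psi f + (- x) * dot l psi y.
  by rewrite -dot_linr//; apply: dot_eq => // t _; ring.
rewrite /= ds0 E2 in k2.
have k3 := dirichlet_ge0 hu ul.
rewrite (dot_linl 1 a y4 s4 u3) (dot_linr 1 a y3 s3 y4) (spsi _ u3)
  (dot_linr 1 a y3 s3 s3) (dotC l f psi) in k3.
move: k1 k2 k3.
set A := dot l psi f; set B := dot l psi y; set D := dot l f y.
set E := dot l y y; set P := dot l psi psi => k1 k2 k3.
have k2' : A = x * B - dy l - a * m by lra.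
have : x * (1 * (1 * E + a * B) + a * (1 * B + a * P)) <= 0.
  by rewrite mulr_le0_ge0// ltW.
rewrite k2' in k3; lra.
Qed.

End WeylPair.

(** * Reduction of the complex-valued problem to real functions *)

Section Complexification.
Set Implicit Arguments. Unset Strict Implicit. Unset Printing Implicit Defensive.
Local Open Scope classical_set_scope.
Local Open Scope ring_scope.
Import numFieldNormedType.Exports.
Context {R : realType}.
Implicit Types (a b k eps : R) (z : Cx R).
Local Notation mu := (@lebesgue_measure R).
Local Notation re := complex.Re.
Local Notation im := complex.Im.

(** Since [q] is real, the equation splits into its real and imaginary parts. *)
Lemma lsol_ac l q (y dy f : R -> Cx R) : lsol l q y dy f ->
  [/\ ac l (fun t => complex.Re (y t)) (fun t => complex.Re (dy t)),
      ac l (fun t => complex.Re (dy t))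
        (fun t => q t * complex.Re (y t) - complex.Re (f t)),
      ac l (fun t => complex.Im (y t)) (fun t => complex.Im (dy t)) &
      ac l (fun t => complex.Im (dy t))
        (fun t => q t * complex.Im (y t) - complex.Im (f t))].
Proof.
move=> H.
have E1 t : complex.Re (rC (q t) * y t - f t) = q t * complex.Re (y t) - complex.Re (f t).
  by case: (y t) (f t) => [? ?] [? ?] /=; ring.
have E2 t : complex.Im (rC (q t) * y t - f t) = q t * complex.Im (y t) - complex.Im (f t).
  by case: (y t) (f t) => [? ?] [? ?] /=; ring.
have ReD (u v : Cx R) : complex.Re (u + v) = complex.Re u + complex.Re v.
  by case: u v => [? ?] [? ?].
have ImD (u v : Cx R) : complex.Im (u + v) = complex.Im u + complex.Im v.
  by case: u v => [? ?] [? ?].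
split=> x lx; have [[i1 i2] [[j1 j2] [e1 e2]]] := H x lx; split => //.
- by rewrite {1}e1 ReD.
- by apply: eq_integrable j1 => // t _; rewrite /= E1.
- by rewrite {1}e2 ReD; congr (_ + _); apply: eq_Rintegral => t _; rewrite E1.
- by rewrite {1}e1 ImD.
- by apply: eq_integrable j2 => // t _; rewrite /= E2.
- by rewrite {1}e2 ImD; congr (_ + _); apply: eq_Rintegral => t _; rewrite E2.
Qed.

Lemma L2_L2r l (y : R -> Cx R) : L2 l y ->
  L2r l (fun t => complex.Re (y t)) /\ L2r l (fun t => complex.Im (y t)).
Proof.
move=> [m1 [m2 i]]; split; split => //; apply: le_integrable i => //.
- by apply/measurable_EFinP; exact: measurable_funX.
- by move=> t _ /=; rewrite lee_fin !ger0_norm ?addr_ge0 ?sqr_ge0// lerDl sqr_ge0.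
- by apply/measurable_EFinP; exact: measurable_funX.
- by move=> t _ /=; rewrite lee_fin !ger0_norm ?addr_ge0 ?sqr_ge0// lerDr sqr_ge0.
Qed.

Lemma maxdom_Hp l q (y dy f : R -> Cx R) : maxdom l q y dy f ->
  Hp l q (fun t => complex.Re (y t)) (fun t => complex.Re (dy t))
    (fun t => complex.Re (f t)) /\
  Hp l q (fun t => complex.Im (y t)) (fun t => complex.Im (dy t))
    (fun t => complex.Im (f t)).
Proof. by move=> [/lsol_ac[? ? ? ?] [/L2_L2r[? ?] /L2_L2r[? ?]]]. Qed.

Lemma Hp_maxdom l q (y dy f : R -> R) : Hp l q y dy f ->
  maxdom l q (fun t => rC (y t)) (fun t => rC (dy t)) (fun t => rC (f t)).
Proof.
have i0 x : mu.-integrable `[l, x] (EFin \o (fun=> 0 : R)) by exact: integrable0.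
have z0 x : Rintegral mu `[l, x] (fun=> 0) = 0 by rewrite Rintegral_cst// mul0r.
have L0 (u : R -> R) : L2r l u -> L2 l (fun t => rC (u t)).
  move=> [mu' iu]; split => //; split => //=.
  by apply: eq_integrable iu => // t _; rewrite /= expr0n/= addr0.
have E t : rC (q t) * rC (y t) - rC (f t) = rC (q t * y t - f t).
  by apply/eqP; rewrite eq_complex /=; apply/andP; split; apply/eqP; ring.
move=> [h1 h2 h3 h4]; split; last by split; exact: L0.
move=> x lx; have [i1 e1] := h1 x lx; have [i2 e2] := h2 x lx.
split; first by split; [exact: i1|exact: i0].
split.
  split; first by apply: eq_integrable i2 => // t _; congr EFin; rewrite E.
  by apply: eq_integrable (i0 x) => // t _; congr EFin; rewrite E.
split; apply/eqP; rewrite eq_complex; apply/andP; split; apply/eqP.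
- exact: e1.
- rewrite [RHS](_ : _ = 0 + Rintegral mu `[l, x] (fun=> 0))//.
  by rewrite add0r z0.
- rewrite [LHS]e2 [RHS](_ : _ = dy l + Rintegral mu `[l, x]
    (fun t => complex.Re (rC (q t) * rC (y t) - rC (f t))))//.
  by congr (_ + _); apply: eq_Rintegral => t _; rewrite E.
- rewrite [RHS](_ : _ = 0 + Rintegral mu `[l, x]
    (fun t => complex.Im (rC (q t) * rC (y t) - rC (f t))))//.
  by rewrite add0r -[LHS](z0 x); apply: eq_Rintegral => t _; rewrite E.
Qed.

Lemma conj_Complex a b : (complex.Complex a b)^* = complex.Complex a (- b) :> Cx R.
Proof. by []. Qed.

Lemma Re_inner l (f y : R -> Cx R) :
  L2r l (fun t => complex.Re (f t)) -> L2r l (fun t => complex.Im (f t)) ->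
  L2r l (fun t => complex.Re (y t)) -> L2r l (fun t => complex.Im (y t)) ->
  complex.Re (inner l f y) =
    dot l (fun t => complex.Re (f t)) (fun t => complex.Re (y t)) +
    dot l (fun t => complex.Im (f t)) (fun t => complex.Im (y t)).
Proof.
move=> f1 f2 y1 y2; rewrite /dot -RintegralD//; try exact: L2r_mul.
apply: eq_Rintegral => t _.
by case: (f t) (y t) => [? ?] [? ?]; rewrite conj_Complex /=; ring.
Qed.

(** For real [x], the real part of the complex Weyl solution is again a solution in L2. Its slope at
    [l] is [Re mc] because [phi_1'(l) = 1] is real. *)
Lemma is_minf_weyl_pair l q x (mc : Cx R) : is_minf l q (rC x) mc ->
  exists phi dphi psi dpsi, weyl_pair l q x (complex.Re mc) phi dphi psi dpsi.
Proof.
move=> [p1 [dp1 [p2 [dp2 [h1 [p10 [dp10 [h2 [p20 [dp20 hL]]]]]]]]]].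
have [a1 a2 a3 a4] := lsol_ac h1; have [b1 b2 b3 b4] := lsol_ac h2.
have [L2psi _] := L2_L2r hL.
have Rex (u : Cx R) : complex.Re (rC x * u) = x * complex.Re u.
  by case: u => ? ? /=; ring.
have Imx (u : Cx R) : complex.Im (rC x * u) = x * complex.Im u.
  by case: u => ? ? /=; ring.
set M := complex.Re mc; set M' := complex.Im mc.
pose comb (u v w : R -> R) t := 1 * u t + 1 * (M * v t + (- M') * w t).
(* The third witness is [Re (p2 + mc * p1)], expanded so that linearity of [ac] applies. *)
exists (fun t => complex.Re (p1 t)), (fun t => complex.Re (dp1 t)),
  (comb (fun t => complex.Re (p2 t)) (fun t => complex.Re (p1 t)) (fun t => complex.Im (p1 t))),
  (comb (fun t => complex.Re (dp2 t)) (fun t => complex.Re (dp1 t)) (fun t => complex.Im (dp1 t))).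
have L2c : L2r l (comb (fun t => complex.Re (p2 t)) (fun t => complex.Re (p1 t))
    (fun t => complex.Im (p1 t))).
  apply: L2r_eq L2psi => t _; rewrite /comb /M /M'.
  by case: (p2 t) (p1 t) (mc) => [? ?] [? ?] [? ?] /=; ring.
split => //.
- by apply: ac_eq a2 _ _ => // t _; rewrite Rex.
- by rewrite p10 dp10.
- split => //.
  + by apply: ac_eq (ac_lin 1 1 b1 (ac_lin M (- M') a1 a3)) _ _ => // t _; ring.
  + apply: ac_eq (ac_lin 1 1 b2 (ac_lin M (- M') a2 a4)) _ _ => // t _.
    by rewrite /comb !Rex Imx; ring.
  + by apply: L2r_eq (L2r_lin x 0 L2c L2c) => t _; ring.
- by rewrite /comb p10 dp10 p20 dp20 /=; split; ring.
Qed.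

(** The term ['i * a * a^*] is purely imaginary, so only the Dirichlet form remains. *)
Lemma Re_form_infty (I a b : Cx R) : re (I - (b - 'i * a) * a^* ) =
  re I - (re a * re b + im a * im b).
Proof.
have iE : 'i = complex.Complex 0 1 :> Cx R by [].
by rewrite iE; case: I a b => [? ?] [? ?] [? ?]; rewrite conj_Complex /=; ring.
Qed.

(** Uses [1 / (k - i) = (k + i) / (k^2 + 1)]. Since [(k^2 - 1) / (k^2 + 1) = 1 - 2 / (k^2 + 1)], the
    result is the Dirichlet form plus [(k |b|^2 + 2 Re (b a^* ) - k |a|^2) / (k^2 + 1)]. *)
Lemma Re_form_finite (I a b : Cx R) k :
  re (I - (b - 'i * a) / (rC k - 'i) * (rC k * a^* - b^* )) =
  re I - ((k ^+ 2 - 1) * (re a * re b + im a * im b) +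
    k * (re a ^+ 2 + im a ^+ 2 - re b ^+ 2 - im b ^+ 2)) / (k ^+ 2 + 1).
Proof.
have iE : 'i = complex.Complex 0 1 :> Cx R by [].
have k1 : k ^+ 2 + 1 != 0 by rewrite gt_eqF// ltr_wpDl// sqr_ge0.
have -> : (rC k - 'i)^-1 = complex.Complex (k / (k ^+ 2 + 1)) (1 / (k ^+ 2 + 1)) :> Cx R.
  rewrite -[LHS]mul1r; apply/eqP; rewrite eq_sym -subr_eq0.
  have u0 : rC k - 'i != 0 :> Cx R.
    by rewrite iE eq_complex /= negb_and orbC sub0r oppr_eq0 oner_eq0.
  rewrite subr_eq0 eq_sym mul1r -(inj_eq (mulfI u0)) mulfV// iE.
  rewrite eq_complex /=; apply/andP; split; apply/eqP; by field.
rewrite iE; case: I a b => [? ?] [? ?] [? ?]; rewrite !conj_Complex /=; field.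
exact: k1.
Qed.

Lemma normC_Re_lt (z : Cx R) (r eps : R) : `|z - rC r| < rC eps -> `|re z - r| < eps.
Proof.
case: z => [c d]; rewrite /rC => h.
have : complex.Complex (Num.sqrt ((c - r) ^+ 2 + (d - 0) ^+ 2)) 0 < complex.Complex eps 0 :> Cx R by exact: h.
rewrite ltcE /= => /andP[_]; apply: le_lt_trans.
by rewrite -sqrtr_sqr ler_wsqrtr// lerDl sqr_ge0.
Qed.

Lemma Re_inner_rC l (f y : R -> R) : L2r l f -> L2r l y ->
  re (inner l (fun t => rC (f t)) (fun t => rC (y t))) = dot l f y.
Proof.
move=> hf hy; have z0 : L2r l (fun=> 0 : R).
  by apply: L2r_eq (L2r_lin 0 0 hf hf) => t _; rewrite !mul0r addr0.
rewrite (@Re_inner l (fun t => rC (f t)) (fun t => rC (y t)) hf z0 hy z0).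
rewrite [X in _ + X](_ : _ = 0) ?addr0//.
have := dot_linl 0 0 hf hf z0; rewrite !mul0r addr0 => <-.
by apply: dot_eq => // t _; rewrite !mul0r addr0.
Qed.

End Complexification.

(** * The accretivity criterion *)

Theorem theorem12 (R : realType) (l : R) (q : R -> R) :
  0 <= l -> loc_summable l q -> deficiency11 l q -> min_nonneg l q ->
  forall L : R, minf_left_limit l q L -> 0 <= L ->
  forall alpha : R, 0 < alpha <= pi ->
    (accretive_L l q alpha <-> tan_ge_inv alpha L).
Proof.
move=> _ _ _ minC L limL L0 alpha _.
have min0 (y dy f : R -> R) : Hp l q y dy f -> y l = 0 -> dy l = 0 -> 0 <= dot l f y.
  move=> /[dup] /Hp_maxdom hm [_ _ h3 h4] y0 dy0.
  have := minC _ _ _ hm; rewrite y0 dy0 => /(_ erefl erefl).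
  by rewrite complex.lecE => /andP[_]; rewrite Re_inner_rC.
(* A single small parameter controls both [|x|] and [|m - L|]. *)
have wps eps : 0 < eps -> exists x m (phi dphi psi dpsi : R -> R),
    [/\ weyl_pair l q x m phi dphi psi dpsi, - eps < x, x < 0 & `|m - L| < eps].
  move=> e0; have [d d0 hd] := limL _ e0.
  pose x := - (Num.min d eps / 2).
  have me : 0 < Num.min d eps by rewrite lt_min d0.
  have m1 : Num.min d eps <= d by rewrite ge_min lexx.
  have m2 : Num.min d eps <= eps by rewrite ge_min lexx orbT.
  have hx : - d < x < 0 by rewrite /x; lra.
  have [mc [/is_minf_weyl_pair[phi [dphi [psi [dpsi wp]]]] /normC_Re_lt hm]] := hd x hx.
  by exists x, (complex.Re mc), phi, dphi, psi, dpsi; split => //; rewrite /x; lra.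
(* Sum [energy_ge] over real and imaginary parts and let [eps] tend to 0: replacing [m] by [L] costs
   at most [eps * A], and the term in [x] at most [eps * N]. *)
have lower (y dy f : R -> Cx R) : maxdom l q y dy f ->
    L * (complex.Re (y l) ^+ 2 + complex.Im (y l) ^+ 2) <=
    complex.Re (inner l f y) -
    (complex.Re (y l) * complex.Re (dy l) + complex.Im (y l) * complex.Im (dy l)).
  move=> /maxdom_Hp[/[dup] r [_ _ r3 r4] /[dup] i [_ _ i3 i4]]; rewrite Re_inner//.
  set N := dot l (fun t => complex.Re (y t)) (fun t => complex.Re (y t)) +
    dot l (fun t => complex.Im (y t)) (fun t => complex.Im (y t)).
  set A := complex.Re (y l) ^+ 2 + complex.Im (y l) ^+ 2.
  rewrite -subr_le0; apply: (@le0_of_eps R _ (A + N)) => eps e0 _.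
  have [x [m [phi [dphi [psi [dpsi [wp xe x0]]]]]]] := wps _ e0.
  rewrite ltr_norml => /andP[mL _].
  have := energy_ge wp x0 min0 r; have := energy_ge wp x0 min0 i => /=.
  have N0 : 0 <= N by rewrite addr_ge0// dot_ge0.
  have A0 : 0 <= A by rewrite addr_ge0// sqr_ge0.
  have h1 : (- eps) * N <= x * N by rewrite ler_wpM2r// ltW.
  have h2 : (L - eps) * A <= m * A by rewrite ler_wpM2r//; lra.
  move: h1 h2; rewrite /N /A; lra.
split.
- move=> acc; have [->|ai] := eqVneq alpha (pi / 2); [by left|right].
  set k := tan alpha; have k1 : 0 < k ^+ 2 + 1 by rewrite ltr_wpDl// sqr_ge0.
  (* This is [k^2 + 1] times the infimum of the real part of the form over real elements with
     boundary values [a] and [b]; [near_minimizer] approaches that infimum. *)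
  have Q (a b : R) : 0 <= k * b ^+ 2 + 2 * a * b + (L * (k ^+ 2 + 1) - k) * a ^+ 2.
    rewrite -oppr_le0; apply: (@le0_of_eps R _ ((k ^+ 2 + 1) * (a ^+ 2 + 1))) => eps e0 _.
    have [x [m [phi [dphi [psi [dpsi [wp _ x0]]]]]]] := wps _ e0.
    rewrite ltr_norml => /andP[_ mL].
    have [y [dy [f [/[dup] hy [_ _ y3 y4] ya yb ub]]]] := near_minimizer wp x0 a b e0.
    have := acc _ _ _ (Hp_maxdom hy); rewrite /state_form (negbTE ai) -/k.
    rewrite Re_form_finite Re_inner_rC//.
    rewrite /= ya yb => h.
    have {}h : ((k ^+ 2 - 1) * (a * b) + k * (a ^+ 2 - b ^+ 2)) / (k ^+ 2 + 1) <= dot l f y.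
      move: h; rewrite subr_ge0; apply: le_trans; rewrite le_eqVlt; apply/orP; left.
      apply/eqP; congr (_ / _); ring.
    rewrite ler_pdivrMr// in h.
    have h' : dot l f y * (k ^+ 2 + 1) <= (a * b + L * a ^+ 2 + eps * (a ^+ 2 + 1)) * (k ^+ 2 + 1).
      apply: ler_wpM2r; first exact: ltW.
      have : m * a ^+ 2 <= (L + eps) * a ^+ 2 by rewrite ler_wpM2r ?sqr_ge0//; lra.
      lra.
    lra.
  have k0 : 0 < k.
    have kge : 0 <= k by have := Q 0 1; lra.
    rewrite lt_neqAle kge andbT eq_sym; apply/eqP => k00.
    (* With [k = 0] this value would be [- L - 2]. *)
    by have := Q 1 (- (L + 1)); rewrite k00; lra.
  have kL : k^-1 <= L.
    (* For [a = 1] the quadratic in [b] has its minimum at [- 1 / k]. *)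
    have := Q 1 (- k^-1).
    have -> : k * (- k^-1) ^+ 2 + 2 * 1 * (- k^-1) + (L * (k ^+ 2 + 1) - k) * 1 ^+ 2 =
        (L - k^-1) * (k ^+ 2 + 1) by field; rewrite gt_eqF.
    by rewrite pmulr_lge0// subr_ge0.
  have Lp : 0 < L by apply: lt_le_trans kL; rewrite invr_gt0.
  by split => //; rewrite -[leRHS]invrK lef_pV2// posrE invr_gt0.
- move=> tg y dy f hy; have := lower _ _ _ hy; rewrite /state_form.
  set A := complex.Re (inner l f y); set r := complex.Re (y l); set i := complex.Im (y l).
  have [ai low|ai low] := eqVneq alpha (pi / 2).
    (* Here the form is the Dirichlet form itself, so [0 <= L] suffices. *)
    rewrite Re_form_infty; apply: le_trans low.
    by rewrite mulr_ge0// addr_ge0// sqr_ge0.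
  case: tg => [ai'|[Lp Lk]]; first by rewrite ai' eqxx in ai.
  rewrite Re_form_finite -/A -/r -/i.
  set k := tan alpha in Lk *.
  move: low; set s := complex.Re (dy l); set t := complex.Im (dy l) => low.
  have k0 : 0 < k by apply: lt_le_trans Lk; rewrite invr_gt0.
  have k1 : 0 < k ^+ 2 + 1 by rewrite ltr_wpDl// sqr_ge0.
  have kL : k^-1 <= L by rewrite -[leRHS]invrK lef_pV2// posrE invr_gt0.
  rewrite subr_ge0 ler_pdivrMr//.
  have h1 : (r * s + i * t + k^-1 * (r ^+ 2 + i ^+ 2)) * (k ^+ 2 + 1) <= A * (k ^+ 2 + 1).
    apply: ler_wpM2r; first exact: ltW.
    have : k^-1 * (r ^+ 2 + i ^+ 2) <= L * (r ^+ 2 + i ^+ 2).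
      by apply: ler_wpM2r => //; rewrite addr_ge0// sqr_ge0.
    lra.
  apply: le_trans h1; rewrite -subr_ge0.
  (* With [L] lowered to [1 / k], the remaining quadratic form is a sum of squares,
     [|y(l) + k y'(l)|^2 / k]. *)
  have -> : (r * s + i * t + k^-1 * (r ^+ 2 + i ^+ 2)) * (k ^+ 2 + 1) -
     ((k ^+ 2 - 1) * (r * s + i * t) + k * (r ^+ 2 + i ^+ 2 - s ^+ 2 - t ^+ 2)) =
     ((r + k * s) ^+ 2 + (i + k * t) ^+ 2) / k by field; rewrite gt_eqF.
  by rewrite divr_ge0 ?(ltW k0)// addr_ge0// sqr_ge0.
Qed.
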